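(* Let $f\in\mathbf F(w,y,\kappa,\lambda,u,\omega,\omega')$, and assume that $$u>\kappa-\lfloor\lambda\rfloor+\iota',\qquad\tilde\lambda=\min(\kappa-\rho_p(y),\lambda)>0.$$ Let $\tilde g_0=f'(0)p^{-w}-\omega'\in\mathbb Z_p$. Then there is a power series $\tilde f\in\mathbf I^n_0[\tilde\lambda](\mathbb Z_p)$ such that $$\tilde f(t)=p^{-\iota-\kappa}\omega^{-1}\big(1+p^{\iota'+\kappa}t\big)^{-1/y}-p^{-\iota-\kappa}\omega^{-1}+p^{u+\lfloor\lambda\rfloor-\kappa-\iota'}\tilde g(t)$$ for some $\tilde g\in\mathbf I^n_0[\tilde\lambda](\mathbb Z_p)$ and such that $$f'\big(\tilde f(t)\big)p^{-w}=\tilde g_0+\omega'\big(1+p^{\iota'+\kappa}t\big).$$ Moreover, for every integer $j\ge\iota'+\kappa$ and $s'\in\mathbb Z_p$, the congruence $$f'(m)p^{-w}\equiv s'\pmod{p^j}$$ has solutions $m\in\mathbb Z_p$ if and only if $s'\equiv\tilde g_0+\omega'\pmod{p^{\iota'+\kappa}}$. In this case, writing $j'=j-\iota'-\kappa$ and $s'=\tilde g_0+\omega'\big(1+p^{\iota'+\kappa}t\big)$ for some $t\in\mathbb Z_p$ unique modulo $p^{j'}$ (as $s'$ is considered modulo $p^j$), the congruence $f'(m)p^{-w}\equiv s'\pmod{p^j}$ holds if and only if $$m\equiv\tilde f(t)\pmod{p^{j'}}.$$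
   Context: $p$ is a prime, $\mathbb N=\{1,2,\dots\}$, $\rho_p=1/(p-1)$. For a positive rational $y$: $\iota(y)=\max(0,-\mathrm{ord}_py)$, $\iota'(y)=\max(0,\mathrm{ord}_py)$; $\iota,\iota'$ without argument mean $\iota(y),\iota'(y)$. $\rho_p(y)=\rho_p$ if $\mathrm{ord}_py\ne0$ and $\rho_p(y)=0$ otherwise. $\mathbf I_0(\mathbb Z_p)$ is the set of power series $\sum_{k\ge0}a_kt^k$ with $a_k\in\mathbb Z_p$, $|a_k|_p\to0$; for real $\lambda\ge0$, $\mathbf I_0[\lambda](\mathbb Z_p)=\{a\in\mathbf I_0(\mathbb Z_p):\mathrm{ord}_pa_k\ge\lceil k\lambda\rceil\ \forall k\ge0\}$ and $\mathbf I^n_0[\lambda](\mathbb Z_p)=t\,\mathbf I_0[\lambda](\mathbb Z_p)$ (the superscript $n$ is just a label). $(1+x)^y=\sum_k\binom ykx^k$. Let $w\in\mathbb Z$, $u,\kappa\in\mathbb N$ with $\kappa\ge1+\iota'(2)$, $\lambda\in\rho_p\mathbb N$, $y\in\mathbb Q^+$, $\omega,\omega'\in\mathbb Z_p^\times$. A power series $f\in\mathbb Q_p^\times\mathbf I_0(\mathbb Z_p)$ belongs to $\mathbf F(w,y,\kappa,\lambda,u,\omega,\omega')$ if $f'(t)=p^w\omega'(1+p^{\iota+\kappa}\omega t)^{-y}+p^w\gamma_0+p^{u+w}g(t)$ for some $\gamma_0\in\mathbb Z_p$ and $g\in\mathbf I_0[\lambda](\mathbb Z_p)$. *)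

(* Defs.v *)
From HB Require Import structures.
From mathcomp Require Import all_boot all_order all_algebra.
From mathcomp Require Import generic_quotient fraction archimedean.
From mathcomp Require Import boolp classical_sets constructive_ereal.

Set Implicit Arguments.
Unset Strict Implicit.
Unset Printing Implicit Defensive.

Import Order.TTheory GRing.Theory Num.Theory.
Local Open Scope ring_scope.

(* Z_p is the projective limit of the rings Z/p^n: an element is the sequence *)
(* of its least nonnegative residues modulo p^0, p^1, p^2, ...; the coherence *)
(* condition also forces residue x n < p ^ n.                                 *)
Record padic_int (p : nat) (p_pr : prime p) := PadicInt {
  residue : nat -> nat;
  residueS_mod : forall n, residue n = (residue n.+1 %% p ^ n)%N }.

HB.instance Definition _ p (p_pr : prime p) := gen_eqMixin (padic_int p_pr).
HB.instance Definition _ p (p_pr : prime p) := gen_choiceMixin (padic_int p_pr).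

Section PadicIntRing.

Context {p : nat} {p_pr : prime p}.
Implicit Types (x y z : padic_int p_pr) (n N : nat).

Lemma padic_int_inj x y : residue x =1 residue y -> x = y.
Proof.
case: x y => [x hx] [y hy] /= xy; have exy : x = y by apply/funext.
by case: y / exy {xy} hy => hy; congr PadicInt; apply: Prop_irrelevance.
Qed.

Lemma residue_mod x n N : (n <= N)%N -> residue x n = (residue x N %% p ^ n)%N.
Proof.
move/subnK <-; elim: (N - n)%N => [|k IHk].
  by rewrite add0n residueS_mod modn_mod.
rewrite IHk addSn residueS_mod modn_dvdm //.
by rewrite dvdn_exp2l // leq_addl.
Qed.

Lemma residue_small x n : (residue x n %% p ^ n)%N = residue x n.
Proof. by rewrite -residue_mod. Qed.

Lemma padic_int_of_proof (f : nat -> nat) :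
    (forall n, f n = f n.+1 %[mod p ^ n]) ->
  forall n, (f n %% p ^ n = (f n.+1 %% p ^ n.+1) %% p ^ n)%N.
Proof. by move=> fP n; rewrite modn_dvdm ?dvdn_exp2l. Qed.

Definition padic_int_of f fP : padic_int p_pr :=
  PadicInt p_pr (@padic_int_of_proof f fP).

Lemma modS x n : residue x n = residue x n.+1 %[mod p ^ n].
Proof. by rewrite residueS_mod modn_mod. Qed.

Lemma padic_int_cst_proof (m : nat) n : m = m %[mod p ^ n]. Proof. by []. Qed.
Definition padic_int0 := padic_int_of (padic_int_cst_proof 0).
Definition padic_int1 := padic_int_of (padic_int_cst_proof 1).

Lemma padic_int_add_proof x y n :
  (residue x n + residue y n = residue x n.+1 + residue y n.+1 %[mod p ^ n])%N.
Proof. by rewrite -modnDm modS (modS y) modnDm. Qed.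
Definition padic_int_add x y := padic_int_of (padic_int_add_proof x y).

Lemma padic_int_mul_proof x y n :
  (residue x n * residue y n = residue x n.+1 * residue y n.+1 %[mod p ^ n])%N.
Proof. by rewrite -modnMm modS (modS y) modnMm. Qed.
Definition padic_int_mul x y := padic_int_of (padic_int_mul_proof x y).

Lemma residue_le x n : (residue x n <= p ^ n)%N.
Proof.
by rewrite -residue_small ltnW // ltn_pmod // expn_gt0 prime_gt0.
Qed.

Lemma padic_int_opp_proof x n :
  (p ^ n - residue x n = p ^ n.+1 - residue x n.+1 %[mod p ^ n])%N.
Proof.
apply/eqP; rewrite -(eqn_modDr (residue x n)) subnK ?residue_le //.
rewrite -modnDmr modS modnDmr subnK ?residue_le // modnn.
by rewrite expnS modnMl.
Qed.
Definition padic_int_opp x := padic_int_of (padic_int_opp_proof x).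

Fact padic_int_addA : associative padic_int_add.
Proof. by move=> x y z; apply: padic_int_inj => n /=; rewrite modnDmr modnDml addnA. Qed.
Fact padic_int_addC : commutative padic_int_add.
Proof. by move=> x y; apply: padic_int_inj => n /=; rewrite addnC. Qed.
Fact padic_int_add0 : left_id padic_int0 padic_int_add.
Proof. by move=> x; apply: padic_int_inj => n /=; rewrite mod0n residue_small. Qed.
Fact padic_int_addN : left_inverse padic_int0 padic_int_opp padic_int_add.
Proof.
move=> x; apply: padic_int_inj => n /=.
by rewrite modnDml subnK ?residue_le // modnn mod0n.
Qed.
HB.instance Definition _ := GRing.isZmodule.Build (padic_int p_pr)
  padic_int_addA padic_int_addC padic_int_add0 padic_int_addN.

Fact padic_int_mulA : associative padic_int_mul.
Proof. by move=> x y z; apply: padic_int_inj => n /=; rewrite modnMmr modnMml mulnA. Qed.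
Fact padic_int_mulC : commutative padic_int_mul.
Proof. by move=> x y; apply: padic_int_inj => n /=; rewrite mulnC. Qed.
Fact padic_int_mul1 : left_id padic_int1 padic_int_mul.
Proof. by move=> x; apply: padic_int_inj => n /=; rewrite modnMml mul1n residue_small. Qed.
Fact padic_int_mulDl : left_distributive padic_int_mul padic_int_add.
Proof.
by move=> x y z; apply: padic_int_inj => n /=; rewrite modnMml modnDm mulnDl.
Qed.
Fact padic_int1_neq0 : padic_int1 != padic_int0.
Proof.
apply/eqP => /(congr1 (fun x => residue x 1)) /=.
by rewrite expn1 mod0n modn_small ?prime_gt1.
Qed.
HB.instance Definition _ := GRing.Zmodule_isComNzRing.Build (padic_int p_pr)
  padic_int_mulA padic_int_mulC padic_int_mul1 padic_int_mulDl padic_int1_neq0.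

Definition padic_int_unit : {pred padic_int p_pr} :=
  [pred x | `[< exists y, y * x = 1 >]].
Definition padic_int_inv x : padic_int p_pr := xget x [set y | y * x = 1].

Fact padic_int_mulVx : {in padic_int_unit, left_inverse 1 padic_int_inv *%R}.
Proof. by move=> x /asboolP; apply: (xgetPex x). Qed.
Fact padic_int_unitPl x y : y * x = 1 -> padic_int_unit x.
Proof. by move=> yx1; apply/asboolP; exists y. Qed.
Fact padic_int_invr_out : {in [predC padic_int_unit], padic_int_inv =1 id}.
Proof.
move=> x /asboolPn x_nunit; rewrite /padic_int_inv.
by case: xgetP => // y _ yx1; case: x_nunit; exists y.
Qed.
HB.instance Definition _ := GRing.ComNzRing_hasMulInverse.Build (padic_int p_pr)
  padic_int_mulVx padic_int_unitPl padic_int_invr_out.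

Lemma padic_int_neq0 x : x != 0 -> exists n, residue x n.+1 != 0%N.
Proof.
move=> x_neq0; apply: contrapT => /forallNP x0; case/eqP: x_neq0.
apply: padic_int_inj => n; rewrite [RHS]mod0n.
by move: (x0 n) => /negP/negPn/eqP x0n; rewrite residueS_mod x0n mod0n.
Qed.

(* The largest n such that p^n divides x, if x != 0; 0 if x = 0 *)
Definition padic_int_val x : nat :=
  if pselect (exists n, residue x n.+1 != 0%N) is left h then ex_minn h else 0%N.

Lemma residue_eq0 x n : x != 0 -> (residue x n == 0%N) = (n <= padic_int_val x)%N.
Proof.
move=> /padic_int_neq0 x_neq0; rewrite /padic_int_val.
case: pselect => // h; case: ex_minnP => v xv v_min.
apply/eqP/idP => [xn0|n_le_v].
  by rewrite leqNgt; apply: contra xv => vn; rewrite (residue_mod x vn) xn0 mod0n.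
case: n n_le_v => [|n] n_lt_v; first by rewrite residueS_mod modn1.
by apply/eqP; apply: contraLR n_lt_v => /v_min; rewrite -leqNgt.
Qed.

Lemma residueM_eq0 x y n : x != 0 -> y != 0 ->
  (residue (x * y) n == 0%N) = (n <= padic_int_val x + padic_int_val y)%N.
Proof.
move=> x_neq0 y_neq0; set v := padic_int_val x; set w := padic_int_val y.
pose N := (n + v + w).+1.
have valE z m : z != 0 -> (m <= N)%N ->
    (p ^ m %| residue z N)%N = (m <= padic_int_val z)%N.
  by move=> z_neq0 mN; rewrite -residue_eq0 // (residue_mod z mN).
have logE z : z != 0 -> (padic_int_val z < N)%N ->
    (0 < residue z N)%N /\ logn p (residue z N) = padic_int_val z.
  move=> z_neq0 zN; have zN_gt0 : (0 < residue z N)%N.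
    by rewrite lt0n residue_eq0 // -ltnNge.
  have leE k : (k <= N)%N -> (k <= logn p (residue z N))%N = (k <= padic_int_val z)%N.
    by move=> kN; rewrite -pfactor_dvdn // valE.
  by split=> //; apply/eqP; rewrite eqn_leq leqNgt !leE ?ltnn ?leqnn // ltnW.
have [||xN_gt0 xN] := logE x; rewrite ?ltnS /v ?leq_addr // -?addnA //.
  by rewrite addnCA leq_addr.
have [||yN_gt0 yN] := logE y; rewrite ?ltnS ?leq_addl //.
have nN : (n <= N)%N by rewrite /N -addnA ltnW // ltnS leq_addr.
rewrite (residue_mod _ nN) /= modn_dvdm ?dvdn_exp2l //.
by rewrite -[_ == _]/(p ^ n %| _)%N pfactor_dvdn ?muln_gt0 ?xN_gt0 // lognM // xN yN.
Qed.

Fact padic_int_integral : GRing.integral_domain_axiom (padic_int p_pr).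
Proof.
move=> x y xy0; apply: contraT; rewrite negb_or => /andP[x_neq0 y_neq0].
have := residueM_eq0 (padic_int_val x + padic_int_val y).+1 x_neq0 y_neq0.
by rewrite xy0 ltnn [residue _ _]mod0n eqxx.
Qed.
HB.instance Definition _ :=
  GRing.ComUnitRing_isIntegral.Build (padic_int p_pr) padic_int_integral.

Lemma padic_int_valM x y : x != 0 -> y != 0 ->
  padic_int_val (x * y) = (padic_int_val x + padic_int_val y)%N.
Proof.
move=> x_neq0 y_neq0; have xy_neq0 : x * y != 0 by rewrite mulf_neq0.
apply/eqP; rewrite eqn_leq -residueM_eq0 // residue_eq0 // leqnn /=.
by rewrite -residue_eq0 // residueM_eq0.
Qed.

End PadicIntRing.

Definition padic (p : nat) (p_pr : prime p) := {fraction padic_int p_pr}.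
HB.instance Definition _ p (p_pr : prime p) := GRing.Field.on (padic p_pr).

Definition padic_of_int p (p_pr : prime p) (x : padic_int p_pr) : padic p_pr :=
  FracField.tofrac x.
Notation "z %:Qp" := (padic_of_int z) (at level 1, format "z %:Qp") : ring_scope.

Section PadicNumbers.

Context {p : nat} {p_pr : prime p}.
Local Notation Zp := (padic_int p_pr).
Local Notation Qp := (padic p_pr).

(* The value on a fraction does not depend on the representative chosen by    *)
(* repr, see padic_ordE; ord 0 = +oo.                                         *)
Definition padic_ord (x : Qp) : \bar int :=
  if x == 0 then +oo%E
  else let r := repr (x : {fraction Zp}) in
       ((padic_int_val \n_r)%:Z - (padic_int_val \d_r)%:Z)%:E.

Lemma padic_ordE (a b : Zp) : a != 0 -> b != 0 ->
  padic_ord (a%:Qp / b%:Qp) = ((padic_int_val a)%:Z - (padic_int_val b)%:Z)%:E.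
Proof.
move=> a_neq0 b_neq0; set x := _ / _.
have bF_neq0 : b%:Qp != 0 by rewrite /padic_of_int tofrac_eq0.
have aF_neq0 : a%:Qp != 0 by rewrite /padic_of_int tofrac_eq0.
have x_neq0 : x != 0 by rewrite mulf_neq0 ?invr_eq0.
rewrite /padic_ord (negPf x_neq0); set r := repr _.
have xE : x = \pi_(FracField.type Zp)%qT (Ratio a b).
  apply: (mulIf bF_neq0); rewrite /x divfK // /padic_of_int.
  unlock FracField.tofrac; rewrite -[RHS]FracField.pi_mul.
  apply/eqmodP; rewrite /= /FracField.equivf /FracField.mulf.
  by rewrite !numden_Ratio ?mulf_neq0 ?oner_eq0 // mulr1 mul1r.
have rE : \n_r * b = \d_r * a.
  apply/eqP; have := FracField.equivf_def r (Ratio a b).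
  by rewrite !numden_Ratio // -xE /r reprK eqxx.
have d_neq0 : \d_r != 0 by apply: denom_ratioP.
have n_neq0 : \n_r != 0.
  by apply: contraNneq (mulf_neq0 d_neq0 a_neq0) => n0; rewrite -rE n0 mul0r.
have /(congr1 Posz) := congr1 padic_int_val rE; rewrite !padic_int_valM // !PoszD => vE.
congr EFin; apply/eqP; rewrite subr_eq addrAC eq_sym subr_eq.
by rewrite addrC -vE addrC.
Qed.

(* |x|_p = p^(- ord x), which is rational; the fallback value is |0|_p = 0.   *)
Definition padic_abs (x : Qp) : rat :=
  if padic_ord x is n%:E then p%:R ^ (- n) else 0.

Definition padic_cvg (u : nat -> Qp) (l : Qp) : Prop :=
  forall eps : rat, 0 < eps ->
    exists N : nat, forall n, (N <= n)%N -> padic_abs (u n - l) < eps.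

Definition padic_integral (x : Qp) : Prop := exists z : Zp, x = z%:Qp.

(* x = y modulo p^j Z_p *)
Definition eq_mod_pow (j : int) (x y : Qp) : Prop :=
  exists z : Zp, x - y = p%:R ^ j * z%:Qp.

(* Formal power series over Q_p, as their coefficient sequences. *)
Implicit Types (a b f g h : nat -> Qp).

Definition ps_deriv a : nat -> Qp := fun k => k.+1%:R * a k.+1.

(* Formal substitution a(b(t)): when b has no constant term (the only meant   *)
(* use), its coefficient of t^n only involves the coefficients of index at    *)
(* most n of a and b, so that it can be computed on truncations.              *)
Definition ps_comp a b : nat -> Qp :=
  fun n => ((\poly_(k < n.+1) a k) \Po (\poly_(k < n.+1) b k))`_n.

(* The p-adic sum of the series at x; the junk value 0 if it diverges.        *)
Definition ps_eval a (x : Qp) : Qp :=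
  xget 0 [set v | padic_cvg (fun n => \sum_(k < n) a k * x ^+ k) v].

Definition gbinom (y : Qp) (k : nat) : Qp :=
  (\prod_(i < k) (y - i%:R)) / k`!%:R.

(* (1 + c t)^y *)
Definition binomial_ps (y : rat) (c : Qp) : nat -> Qp :=
  fun k => gbinom (ratr y) k * c ^+ k.

(* I0, I0w lam and In0w lam are the sets I_0(Z_p), I_0[lam](Z_p) and          *)
(* I^n_0[lam](Z_p) = t I_0[lam](Z_p).                                         *)
Definition I0 a : Prop :=
  (forall k, padic_integral (a k)) /\ padic_cvg a 0.

Definition I0w (R : archiRealFieldType) (lam : R) a : Prop :=
  I0 a /\ forall k, ((Num.ceil (k%:R * lam))%:E <= padic_ord (a k))%E.

Definition In0w (R : archiRealFieldType) (lam : R) a : Prop :=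
  exists2 b, I0w lam b & forall k, a k = if k is k'.+1 then b k' else 0.

End PadicNumbers.

(* Meant for y != 0.                                                          *)
Definition rat_ord (p : nat) (y : rat) : int :=
  (logn p `|numq y|)%:Z - (logn p `|denq y|)%:Z.

Definition iota_p (p : nat) (y : rat) : int := Num.max 0 (- rat_ord p y).
Definition iota'_p (p : nat) (y : rat) : int := Num.max 0 (rat_ord p y).

Definition rho (p : nat) : rat := (p%:R - 1)^-1.
Definition rho_at (p : nat) (y : rat) : rat :=
  if rat_ord p y != 0 then rho p else 0.

Definition class_F (p : nat) (p_pr : prime p) (w : int) (y : rat) (kappa : nat)
    (lam : rat) (u : nat) (omega omega' : padic_int p_pr)
    (f : nat -> padic p_pr) : Prop :=
  (exists2 c : padic p_pr, c != 0 &
     exists2 h, I0 h & forall k, f k = c * h k) /\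
  (exists gamma0 : padic_int p_pr, exists2 g, I0w lam g &
     forall k, ps_deriv f k =
       p%:R ^ w * omega'%:Qp
         * binomial_ps (- y) (p%:R ^ (iota_p p y + kappa%:Z) * omega%:Qp) k
       + (p%:R ^ w * gamma0%:Qp)%:P`_k
       + p%:R ^ (u%:Z + w) * g k).

(* Main.v *)
(* Put Psi = p^(-w) f'. After its constant term, Psi(X) = Psi_0 + p^e' phi(X) *)
(* where the linear coefficient of phi is a unit and phi_k has valuation at   *)
(* least (k-1) lamt, so phi has a compositional inverse with the same bounds, *)
(* read off coefficient by coefficient; ftilde is that inverse at omega' t.   *)
(* The binomial part of phi has an explicit inverse, because the composite of *)
(* (1 + c t)^(-y) and ((1 + d t)^(-1/y) - 1) / c is 1 + d t, and comparing    *)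
(* the two inversions coefficient by coefficient gives gtilde. Finally        *)
(* Psi(m) - Psi(m') is p^e' (m - m') times a unit for all m, m' in Z_p, which *)
(* together with Psi(ftilde(t)) = Psi_0 + p^e' omega' t solves the congruence.*)
From HB Require Import structures.
Require Import Defs.
From mathcomp Require Import all_boot all_order all_algebra.
From mathcomp Require Import fraction archimedean cyclic boolp classical_sets constructive_ereal.
From mathcomp Require Import zify ring lra.

Set Implicit Arguments.
Unset Strict Implicit.
Unset Printing Implicit Defensive.

Import Order.TTheory GRing.Theory Num.Theory.
Local Open Scope ring_scope.

(** The proof rests on one filtration: series vanishing at 0 with ord a_k >= (k-1) mu, for a fixed
    mu > 0. It is stable under substitution ([bnd_ps_comp]). If the linear coefficient of beta is a
    unit, substitution into beta also reflects closeness: X - H inherits the bound of beta(X) -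
    beta(H) ([bnd_ps_comp_inj]).

    Up to a constant and the factor p^e' omega', the binomial part of p^(-w) f' is such a beta
    ([vge_binomial_coef]), with explicit inverse H = ((1 + p^e' t)^(-1/y) - 1) / (p^e omega)
    ([binomial_reversion]). The perturbation p^u g leaves the linear coefficient p^e' times a unit,
    so an exact solution ftilde exists formally ([ps_comp_solve]). Now beta(ftilde) differs from
    beta(H) = t only by the perturbation, which after division by p^e' has size p^(u + floor lam -
    e'); reflecting closeness gives gtilde.

    Because mu > 0, the series converge on Z_p and formal substitution agrees with evaluation
    ([ps_eval_comp]). There p^(-w) f' scales all distances by the same factor |p^e'|
    ([ps_eval_congr]), so a solution modulo p^j is determined exactly modulo p^(j - e'). *)

Section PadicIntegers.

(** * Divisibility, units and completeness of Z_p *)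

Context {p : nat} {p_pr : prime p}.
Local Notation Zp := (padic_int p_pr).
Implicit Types (x y z : Zp) (m n : nat).

Lemma residueD x y n : residue (x + y) n = ((residue x n + residue y n) %% p ^ n)%N.
Proof. by []. Qed.

Lemma residueM x y n : residue (x * y) n = ((residue x n * residue y n) %% p ^ n)%N.
Proof. by []. Qed.

Lemma residue0 n : residue (0 : Zp) n = 0%N.
Proof. exact: mod0n. Qed.

Lemma residue_nat m n : residue (m%:R : Zp) n = (m %% p ^ n)%N.
Proof.
elim: m => [|m IHm]; first by rewrite mulr0n.
by rewrite -addn1 natrD residueD IHm -[residue 1 n]/(1 %% p ^ n)%N modnDm.
Qed.

Lemma residueB_eq0 x y n : residue x n = residue y n -> residue (x - y) n = 0%N.
Proof.
move=> xy; have : residue (x - y + y) n == residue x n by rewrite subrK.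
rewrite residueD -[X in _ == X]residue_small -xy -[X in (_ == X %% _)%N]add0n eqn_modDr.
by rewrite mod0n residue_small => /eqP.
Qed.

(** Division by p^n costs n digits of precision: the quotient modulo p^k is read off from x modulo
    p^(k + n). *)
Lemma padic_int_dvd_expP x n : residue x n = 0%N -> exists z, x = p%:R ^+ n * z.
Proof.
move=> x0; have pn_gt0 k : (0 < p ^ k)%N by rewrite expn_gt0 prime_gt0.
have dvd k : (p ^ n %| residue x (k + n))%N.
  by rewrite /dvdn -(residue_mod x (leq_addl k n)) x0.
have zP k : residue x (k + n) %/ p ^ n = residue x (k.+1 + n) %/ p ^ n %[mod p ^ k].
  apply/eqP; rewrite -(eqn_pmul2r (pn_gt0 n)) !muln_modl -!expnD !divnK ?dvd //.
  by rewrite addSn -residueS_mod residue_small.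
exists (padic_int_of zP); apply: padic_int_inj => k.
rewrite -natrX residueM residue_nat [residue (padic_int_of _) _]/= modnMml modnMmr.
by rewrite mulnC divnK ?dvd // -residue_mod ?leq_addr.
Qed.

Lemma padic_int_approx x n : exists z, x = (residue x n)%:R + p%:R ^+ n * z.
Proof.
have [|z xz] := @padic_int_dvd_expP (x - (residue x n)%:R) n.
  by apply: residueB_eq0; rewrite residue_nat residue_small.
by exists z; rewrite -xz subrKC.
Qed.

Lemma padic_int_unitP x : reflect (residue x 1 <> 0%N) (x \is a GRing.unit).
Proof.
apply: (iffP idP) => [ux x0|/eqP x1].
  have /(congr1 (@residue p p_pr ^~ 1)) := divrr ux.
  rewrite residueM x0 mul0n mod0n -[residue 1 1]/(1 %% p ^ 1)%N.
  by rewrite expn1 modn_small ?prime_gt1.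
have pn_gt0 k : (0 < p ^ k)%N by rewrite expn_gt0 prime_gt0.
have cop k n : (k <= n)%N -> coprime (residue x n) (p ^ k).
  case: k => [|k] kn; first by rewrite coprimen1.
  rewrite coprime_pexpr // coprime_sym prime_coprime //.
  apply: contra x1; rewrite (@residue_mod _ _ x 1 n) 1?expn1 //.
  by case: n kn.
(* By Euler's theorem this power inverts x modulo p^n. The powers are coherent because inverses
   modulo p^n are unique. *)
pose s n := (residue x n ^ (totient (p ^ n)).-1)%N.
have sK n : s n * residue x n = 1 %[mod p ^ n].
  rewrite /s -expnSr prednK ?totient_gt0 //.
  by apply: Euler_exp_totient; apply: cop.
have sP n : s n = s n.+1 %[mod p ^ n].
  have sK' : s n.+1 * residue x n = 1 %[mod p ^ n].
    have := sK n.+1; rewrite (residueS_mod x n) modnMmr.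
    by move=> /(congr1 (modn ^~ (p ^ n)%N)); rewrite !modn_dvdm ?dvdn_exp2l.
  rewrite -[s n]muln1 -modnMmr -sK' modnMmr mulnCA -modnMmr (sK n) modnMmr.
  by rewrite muln1.
apply/unitrP; exists (padic_int_of sP).
suff xs : padic_int_of sP * x = 1 by rewrite (mulrC x).
by apply: padic_int_inj => n; rewrite residueM [residue (padic_int_of _) _]/= modnMml sK.
Qed.

Lemma padic_int_unitD x z : x \is a GRing.unit -> x + p%:R * z \is a GRing.unit.
Proof.
move=> /padic_int_unitP ux; apply/padic_int_unitP; rewrite residueD residueM residue_nat.
rewrite [X in (X * _)%N](_ : _ = 0%N) ?expn1 ?modnn // mul0n mod0n addn0.
by have /= := residue_small x 1; rewrite expn1 => ->.
Qed.

Lemma padic_int_val_decomp x : x != 0 ->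
  exists2 v, v \is a GRing.unit & x = p%:R ^+ padic_int_val x * v.
Proof.
move=> x0; have [|v xv] := @padic_int_dvd_expP x (padic_int_val x).
  by apply/eqP; rewrite residue_eq0.
exists v => //; apply/padic_int_unitP => v0.
have [v' vE] := padic_int_dvd_expP v0.
have : residue x (padic_int_val x).+1 != 0%N by rewrite residue_eq0 // ltnn.
rewrite {1}xv vE mulrA -exprD addn1 -natrX residueM residue_nat modnn mul0n.
by rewrite mod0n.
Qed.

Lemma padic_int_natr_eq0 n : ((n%:R : Zp) == 0) = (n == 0%N).
Proof.
apply/eqP/eqP => [|->]; last by rewrite mulr0n.
move=> n0; have : residue (n%:R : Zp) n = 0%N by rewrite n0 residue0.
by rewrite residue_nat modn_small // ltn_expl ?prime_gt1.
Qed.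

Lemma padic_int_complete (s : nat -> Zp) :
    (forall n, exists z, s n.+1 - s n = p%:R ^+ n * z) ->
  exists l, forall n, exists z, l - s n = p%:R ^+ n * z.
Proof.
move=> sP; have rP n : residue (s n) n = residue (s n.+1) n.+1 %[mod p ^ n].
  rewrite -(modS (s n.+1) n); have [z /eqP] := sP n; rewrite subr_eq => /eqP ->.
  rewrite -natrX.
  by rewrite residueD residueM residue_nat modnn mul0n mod0n add0n modn_mod.
exists (padic_int_of rP) => n; apply: padic_int_dvd_expP.
by apply: residueB_eq0; rewrite [LHS]/= residue_small.
Qed.

End PadicIntegers.

HB.instance Definition _ (p : nat) (p_pr : prime p) :=
  GRing.RMorphism.copy (@padic_of_int p p_pr) (@FracField.tofrac (padic_int p_pr)).

(** * Lower bounds on valuations, congruences and convergence in Q_p *)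

Section Valuation.
Context {p : nat} {p_pr : prime p}.
Local Notation Zp := (padic_int p_pr).
Local Notation Qp := (padic p_pr).
Local Notation "''p'" := (p%:R : Qp).
Implicit Types (x y : Qp) (z : Zp) (r s : rat) (j m : int).

Lemma padic_of_int_eq0 z : (z%:Qp == 0) = (z == 0).
Proof. exact: tofrac_eq0. Qed.

Lemma padic_of_int_inj : injective (@padic_of_int p p_pr).
Proof.
by move=> a b /eqP; rewrite -subr_eq0 -rmorphB padic_of_int_eq0 subr_eq0 => /eqP.
Qed.

Lemma padic_natr_eq0 n : ((n%:R : Qp) == 0) = (n == 0%N).
Proof. by rewrite -(rmorph_nat (@padic_of_int p p_pr)) padic_of_int_eq0 padic_int_natr_eq0. Qed.

Lemma padic_p_neq0 : 'p != 0.
Proof. by rewrite padic_natr_eq0 -lt0n prime_gt0. Qed.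

Lemma padic_pX_neq0 j : 'p ^ j != 0.
Proof. by rewrite expfz_neq0 // padic_p_neq0. Qed.

(* The bound ord x >= r, for a rational r. *)
Definition vge r x := exists2 m : int, r <= m%:~R & exists z, x = 'p ^ m * z%:Qp.

Lemma vge_expP j x : vge j%:~R x <-> exists z, x = 'p ^ j * z%:Qp.
Proof.
split=> [[m]|[z ->]]; last by exists j => //; exists z.
rewrite ler_int => jm [z ->].
exists (p%:R ^+ `|m - j|%N * z); rewrite rmorphM rmorphXn rmorph_nat mulrA.
congr (_ * _); rewrite exprnP -expfzDr ?padic_p_neq0 // -[in LHS](subrKC j m).
by rewrite gez0_abs ?subr_ge0.
Qed.

Lemma vge_le r s x : r <= s -> vge s x -> vge r x.
Proof. by move=> rs [m sm xP]; exists m => //; apply: le_trans sm. Qed.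

(** Valuations are integers, so a rational bound can be rounded up. Two elements with the same bound
    thereby get a common power of p, which is what sums require. *)
Lemma vge_ceilP r x : vge r x <-> vge (Num.ceil r)%:~R x.
Proof.
split=> [[m]|]; last by apply: vge_le; apply: ceil_ge.
by rewrite -ceil_le_int => rm xP; exists m; rewrite ?ler_int.
Qed.

Lemma vge0 r : vge r 0.
Proof. by exists (Num.ceil r); rewrite ?ceil_ge //; exists 0; rewrite rmorph0 mulr0. Qed.

Lemma vge_of_int z : vge 0 z%:Qp.
Proof. by exists 0 => //; exists z; rewrite expr0z mul1r. Qed.

Lemma vge_natr n : vge 0 n%:R.
Proof. by rewrite -(rmorph_nat (@padic_of_int p p_pr)); apply: vge_of_int. Qed.

Lemma vge_exp j : vge j%:~R ('p ^ j).
Proof. by exists j => //; exists 1; rewrite rmorph1 mulr1. Qed.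

Lemma vgeN r x : vge r x -> vge r (- x).
Proof. by move=> [m rm [z ->]]; exists m => //; exists (- z); rewrite rmorphN mulrN. Qed.

Lemma vgeD r x y : vge r x -> vge r y -> vge r (x + y).
Proof.
move=> /vge_ceilP/vge_expP[z ->] /vge_ceilP/vge_expP[z' ->].
by apply/vge_ceilP/vge_expP; exists (z + z'); rewrite rmorphD mulrDr.
Qed.

Lemma vgeB r x y : vge r x -> vge r y -> vge r (x - y).
Proof. by move=> vx vy; apply: vgeD => //; apply: vgeN. Qed.

Lemma vge_sum r (I : Type) (P : pred I) (F : I -> Qp) (t : seq I) :
  (forall i, P i -> vge r (F i)) -> vge r (\sum_(i <- t | P i) F i).
Proof. by move=> FP; elim/big_rec: _ => [|i x Pi vx]; [apply: vge0 | apply: vgeD; auto]. Qed.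

Lemma vgeM r s x y : vge r x -> vge s y -> vge (r + s) (x * y).
Proof.
move=> [m rm [z ->]] [n sn [z' ->]]; exists (m + n); first by rewrite rmorphD lerD.
by exists (z * z'); rewrite expfzDr ?padic_p_neq0 // rmorphM mulrACA.
Qed.

Lemma vgeX r x k : vge r x -> vge (k%:R * r) (x ^+ k).
Proof.
move=> vx; elim: k => [|k IHk]; first by rewrite mul0r expr0; apply: (vge_natr 1).
by rewrite exprS -addn1 natrD mulrDl mul1r addrC; apply: vgeM.
Qed.

Lemma vge_expM j r x : vge r ('p ^ j * x) <-> vge (r - j%:~R) x.
Proof.
split=> vx; last by rewrite -[r](subrKC j%:~R); apply: vgeM => //; apply: vge_exp.
rewrite -[x]mul1r -(mulVf (padic_pX_neq0 j)) invr_expz -mulrA addrC.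
by rewrite -rmorphN /=; apply: vgeM => //; apply: vge_exp.
Qed.

Lemma vge_unitM r z x : z \is a GRing.unit -> vge r (z%:Qp * x) <-> vge r x.
Proof.
move=> uz; split=> vx; last by rewrite -[r]add0r; apply: vgeM => //; apply: vge_of_int.
rewrite -[x]mul1r -(rmorph1 (@padic_of_int p p_pr)) -(mulVr uz) rmorphM -mulrA -[r]add0r.
by apply: vgeM => //; apply: vge_of_int.
Qed.

Lemma eq_mod_powP j x y : eq_mod_pow j x y <-> vge j%:~R (x - y).
Proof. exact: iff_sym (vge_expP _ _). Qed.

Lemma vge_congr r x y : vge r (x - y) -> vge r x <-> vge r y.
Proof.
move=> xy; split=> h; last by rewrite -(subrK y x); apply: vgeD.
by rewrite -(subKr x y); apply: vgeB.
Qed.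

Lemma padic_integralP x : padic_integral x <-> vge 0 x.
Proof.
have -> : vge 0 x = vge 0%:~R x by rewrite mulr0z.
split=> [[z ->]|/vge_expP[z ->]]; last by exists z; rewrite expr0z mul1r.
by rewrite mulr0z; apply: vge_of_int.
Qed.

Lemma padic_decomp x : x != 0 ->
  exists j, exists2 z, z \is a GRing.unit & x = 'p ^ j * z%:Qp /\ padic_ord x = j%:E.
Proof.
move=> x0; pose r := repr (x : {fraction Zp}).
have d0 : \d_r != 0 by apply: denom_ratioP.
have dF0 : (\d_r)%:Qp != 0 by rewrite padic_of_int_eq0.
have xE : x = (\n_r)%:Qp / (\d_r)%:Qp.
  apply: (mulIf dF0); rewrite divfK // -[in LHS](reprK (x : {fraction Zp})) -/r.
  rewrite /padic_of_int; unlock FracField.tofrac; rewrite -[LHS]FracField.pi_mul.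
  apply/eqmodP; rewrite /= /FracField.equivf /FracField.mulf.
  by rewrite !numden_Ratio ?mulf_neq0 ?oner_eq0 // !mulr1 mulrC.
have n0 : \n_r != 0.
  by apply: contraNneq x0; rewrite xE => ->; rewrite rmorph0 mul0r.
have [a ua aE] := padic_int_val_decomp n0; have [b ub bE] := padic_int_val_decomp d0.
exists ((padic_int_val \n_r)%:Z - (padic_int_val \d_r)%:Z), (a / b).
  by rewrite rpredM ?rpredV.
split; last by rewrite xE padic_ordE.
rewrite {1}xE {1}aE {1}bE !rmorphM !rmorphXn rmorph_nat /= rmorphV // invfM mulrACA.
by rewrite expfzDr ?padic_p_neq0 // -invr_expz.
Qed.

Lemma padic_ordP r x : ((Num.ceil r)%:E <= padic_ord x)%E <-> vge r x.
Proof.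
have [->|x0] := eqVneq x 0.
  by rewrite /padic_ord eqxx leey; split=> // _; apply: vge0.
have [j [z uz [xE ->]]] := padic_decomp x0; rewrite lee_fin ceil_le_int.
split=> [rj|[m rm [z' xE']]].
  by exists j => //; exists z.
apply: le_trans rm _; rewrite ler_int leNgt; apply/negP => jm.
have z'E : z = p%:R ^+ `|m - j|%N * z'.
  apply: padic_of_int_inj; apply: (mulfI (padic_pX_neq0 j)).
  rewrite -xE xE' rmorphM rmorphXn rmorph_nat mulrA; congr (_ * _).
  by rewrite exprnP -expfzDr ?padic_p_neq0 // gez0_abs ?subr_ge0 1?ltW // subrKC.
case/padic_int_unitP: uz; rewrite z'E.
have -> : `|m - j|%N = `|m - j|.-1.+1 by rewrite prednK // absz_gt0 subr_eq0 gt_eqF.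
rewrite exprS -mulrA residueM residue_nat.
by rewrite [X in (X * _)%N](_ : _ = 0%N) ?expn1 ?modnn // mul0n mod0n.
Qed.

Lemma padic_cvgP (s : nat -> Qp) x : padic_cvg s x <->
  forall j : int, exists N, forall n, (N <= n)%N -> vge j%:~R (s n - x).
Proof.
have p_gt1 : 1 < (p%:R : rat) by rewrite ltr1n prime_gt1.
(* The exponent is 1 - j because the inequality on absolute values is strict and the valuation is an
   integer. *)
have absP y j : padic_abs y < p%:R ^ (1 - j) <-> vge j%:~R y.
  rewrite -padic_ordP intrKceil /padic_abs.
  have [->|y0] := eqVneq y 0.
    by rewrite /padic_ord eqxx leey exprz_gt0 // (lt_trans ltr01).
  have [k [_ _ [_ ->]]] := padic_decomp y0.
  rewrite lee_fin ltr_eXz2l //; split; lia.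
split=> [sx j|sx eps eps0].
  have [|N NP] := sx (p%:R ^ (1 - j)); first by rewrite exprz_gt0 // (lt_trans ltr01).
  by exists N => n /NP /absP.
have [k kP] : exists k : nat, p%:R ^- k < eps.
  pose k := Num.bound eps^-1; exists k.
  have p_gt0 : 0 < (p%:R : rat) ^+ k by rewrite exprn_gt0 // (lt_trans ltr01).
  rewrite -[eps]invrK ltf_pV2 ?posrE ?invr_gt0 //.
  have h : eps^-1 < k%:R by apply: archi_boundP; rewrite invr_ge0 ltW.
  apply: lt_trans h _.
  by rewrite -natrX ltr_nat ltn_expl // prime_gt1.
have [N NP] := sx (k%:Z + 1); exists N => n /NP h.
apply: lt_trans ((absP _ _).2 h) _.
have -> : 1 - (k%:Z + 1) = - k%:Z by lia.
by rewrite -exprnN.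
Qed.

Lemma vge_all_eq0 x : (forall j : int, vge j%:~R x) -> x = 0.
Proof.
move=> xP; apply/eqP; apply: contraT => x0.
have [k [_ _ [_ kE]]] := padic_decomp x0.
by have := xP (k + 1); rewrite -padic_ordP intrKceil kE lee_fin; lia.
Qed.

End Valuation.

(** * Coefficients of polynomial composites *)

Section PolyComposition.
Context {R : comNzRingType}.
Implicit Types (A P Q K : {poly R}) (a b : nat -> R).

Lemma coefM_low n P Q : (forall i, (i < n)%N -> P`_i = 0) ->
  forall i, (i < n)%N -> (P * Q)`_i = 0.
Proof.
move=> P0 i i_n; rewrite coefM big1 // => j _.
by rewrite P0 ?mul0r // (leq_ltn_trans _ i_n) // -ltnS.
Qed.

Lemma coefX_low Q n : Q`_0 = 0 -> forall i, (i < n)%N -> (Q ^+ n)`_i = 0.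
Proof.
move=> Q0; elim: n => [//|n IHn] i i_n; rewrite exprS coefM big1 // => j _.
have [->|j0] := posnP j; first by rewrite Q0 mul0r.
by rewrite IHn ?mulr0 //; move: (ltn_ord j); lia.
Qed.

Lemma coef_comp_low n A Q : Q`_0 = 0 -> (forall i, (i < n)%N -> A`_i = 0) ->
  forall i, (i < n)%N -> (A \Po Q)`_i = 0.
Proof.
move=> Q0 A0 i i_n; rewrite comp_polyE coef_sum big1 // => j _; rewrite coefZ.
have [j_n|n_j] := ltnP j n; first by rewrite A0 ?mul0r.
by rewrite coefX_low ?mulr0 // (leq_trans i_n).
Qed.

(** The divided difference (P(Q) - P(K)) / (Q - K), expanded so that its coefficients can be
    estimated. *)
Definition comp_quo P Q K : {poly R} :=
  \sum_(i < size P) P`_i *: \sum_(j < i) Q ^+ (i.-1 - j) * K ^+ j.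

Lemma comp_polyB_quo P Q K : (P \Po Q) - (P \Po K) = (Q - K) * comp_quo P Q K.
Proof.
rewrite !comp_polyE -sumrB mulr_sumr; apply: eq_bigr => i _.
by rewrite -scalerBr subrXX scalerAr.
Qed.

(** For i >= 2 every product in the divided difference contains Q or K, which vanish at 0; only the
    linear term of P remains. *)
Lemma coef0_comp_quo P Q K : Q`_0 = 0 -> K`_0 = 0 -> (comp_quo P Q K)`_0 = P`_1.
Proof.
move=> Q0 K0; rewrite coef_sum; under eq_bigr do rewrite coefZ coef_sum.
have E i : (\sum_(j < i) (Q ^+ (i.-1 - j) * K ^+ j)`_0 = (i == 1%N)%:R).
  case: i => [|[|i]]; first by rewrite big_ord0.
    by rewrite big_ord1 mulr1 coefC.
  rewrite big1 // => j _; rewrite coef0M.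
  have [->|j0] := posnP j; first by rewrite subn0 [_`_0]coefX_low ?mul0r.
  by rewrite (coefX_low K0 j0) mulr0.
under eq_bigr do rewrite E.
have [P1|P1] := ltnP 1 (size P).
  rewrite (bigD1 (Ordinal P1)) //= big1 ?addr0 ?mulr1 // => i.
  by rewrite -val_eqE /= => /negPf ->; rewrite mulr0.
rewrite big1 ?nth_default // => i _.
by rewrite (_ : (i == 1 :> nat) = false) ?mulr0 //; apply/eqP; move: (ltn_ord i); lia.
Qed.

Lemma coef_comp_eq n A P Q K : Q`_0 = 0 ->
    (forall i, (i < n)%N -> A`_i = P`_i) -> (forall i, (i < n)%N -> Q`_i = K`_i) ->
  forall i, (i < n)%N -> (A \Po Q)`_i = (P \Po K)`_i.
Proof.
move=> Q0 AP QK i i_n; apply/eqP; rewrite -subr_eq0 -coefB.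
have -> : (A \Po Q) - (P \Po K) = ((A - P) \Po Q) + ((P \Po Q) - (P \Po K)).
  by rewrite comp_polyB addrA subrK.
rewrite coefD comp_polyB_quo (@coef_comp_low n) //; last first.
  by move=> k k_n; rewrite coefB AP ?subrr.
rewrite (@coefM_low n) ?addr0 // => k k_n.
by rewrite coefB QK ?subrr.
Qed.

(** A new top coefficient enters the composite linearly, with slope P_1. This is what allows
    inverses to be computed and compared one coefficient at a time. *)
Lemma coef_comp_addXn n x P Q : Q`_0 = 0 ->
  (P \Po (Q + x *: 'X^(n.+1)))`_n.+1 = (P \Po Q)`_n.+1 + x * P`_1.
Proof.
move=> Q0; apply/eqP; rewrite [eqbRHS]addrC -subr_eq -coefB comp_polyB_quo.
rewrite addrAC subrr add0r -scalerAl coefZ coefXnM ltnn subnn coef0_comp_quo //.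
by rewrite coefD Q0 coefZ coefXn mulr0 addr0.
Qed.

Definition trunc n a : {poly R} := \poly_(k < n.+1) a k.

Lemma coef_trunc n a k : (trunc n a)`_k = if (k <= n)%N then a k else 0.
Proof. by rewrite coef_poly ltnS. Qed.

End PolyComposition.

(** * Weighted bounds under substitution, and formal reversion *)

Section Composition.
Context {p : nat} {p_pr : prime p}.
Local Notation Zp := (padic_int p_pr).
Local Notation Qp := (padic p_pr).
Implicit Types (P Q K : {poly Qp}) (a b : nat -> Qp) (c d r mu : rat).

Lemma coef_comp_trunc N M n a b : b 0%N = 0 -> (n <= N)%N -> (n <= M)%N ->
  (trunc N a \Po trunc M b)`_n = ps_comp a b n.
Proof.
move=> b0 nN nM; apply: (@coef_comp_eq _ n.+1) => //.
- by rewrite coef_trunc b0.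
- by move=> i; rewrite !coef_trunc ltnS => i_n; rewrite i_n (leq_trans i_n).
- by move=> i; rewrite !coef_trunc ltnS => i_n; rewrite i_n (leq_trans i_n).
Qed.

Lemma ps_comp_id0 a b : b 0%N = 0 -> ps_comp a b 0 = a 0%N.
Proof.
move=> b0; rewrite /ps_comp -horner_coef0 horner_comp horner_coef0 coef_trunc b0.
by rewrite horner_coef0 coef_trunc.
Qed.

(* When mu > 0, the elements of t I_0[mu] are the a with a_0 = 0 and          *)
(* bnd (- mu) mu a.                                                           *)
Definition bnd c mu a := forall k, vge (c + k%:R * mu) (a k).

Lemma bnd_le c d mu a : c <= d -> bnd d mu a -> bnd c mu a.
Proof. by move=> cd ad k; apply: vge_le (ad k); rewrite lerD2r. Qed.

Lemma bnd_trunc c mu n a : bnd c mu a -> bnd c mu (nth 0 (trunc n a)).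
Proof. by move=> ac k; rewrite coef_trunc; case: ifP => // _; apply: vge0. Qed.

Lemma bndD c mu a b : bnd c mu a -> bnd c mu b -> bnd c mu (fun k => a k + b k).
Proof. by move=> ac bc k; apply: vgeD. Qed.

Lemma bndZ r c mu x a : vge r x -> bnd c mu a -> bnd (r + c) mu (fun k => x * a k).
Proof. by move=> xr ac k; rewrite -addrA; apply: vgeM. Qed.

Lemma bnd_polyM c d mu P Q : bnd c mu (nth 0 P) -> bnd d mu (nth 0 Q) ->
  bnd (c + d) mu (nth 0 (P * Q)).
Proof.
move=> Pc Qd k; rewrite coefM; apply: vge_sum => i _.
have -> : c + d + k%:R * mu = (c + i%:R * mu) + (d + (k - i)%N%:R * mu).
  by rewrite addrACA -mulrDl -natrD subnKC // -ltnS.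
exact: vgeM.
Qed.

Lemma bnd_polyX c mu P n : bnd c mu (nth 0 P) -> bnd (n%:R * c) mu (nth 0 (P ^+ n)).
Proof.
move=> Pc; elim: n => [|n IHn]; last first.
  by rewrite exprS -addn1 natrD mulrDl mul1r addrC; apply: bnd_polyM.
move=> k; rewrite expr0 coef1 mul0r add0r; case: k => [|k]; last exact: vge0.
by rewrite mul0r; apply: (vge_natr 1).
Qed.

(** The loss i mu in the bound for Q^i is exactly the gain i mu in the bound for P_i. *)
Lemma bnd_comp c mu P Q : bnd c mu (nth 0 P) -> bnd (- mu) mu (nth 0 Q) ->
  bnd c mu (nth 0 (P \Po Q)).
Proof.
move=> Pc Qmu k; rewrite comp_polyE coef_sum; apply: vge_sum => i _; rewrite coefZ.
have := bndZ (Pc i) (bnd_polyX i Qmu); move=> /(_ k); apply: vge_le.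
lra.
Qed.

(** P_i contributes (i - 1) mu, and the i - 1 factors Q and K lose the same amount. *)
Lemma bnd_comp_quo mu P Q K : bnd (- mu) mu (nth 0 P) ->
    bnd (- mu) mu (nth 0 Q) -> bnd (- mu) mu (nth 0 K) ->
  bnd 0 mu (nth 0 (comp_quo P Q K)).
Proof.
move=> Pm Qm Km k; rewrite coef_sum; apply: vge_sum => i _; rewrite coefZ coef_sum.
rewrite mulr_sumr; apply: vge_sum => j _.
have := bndZ (Pm i) (bnd_polyM (bnd_polyX (i.-1 - j) Qm) (bnd_polyX j Km)) k.
have -> : (i.-1 - j)%N%:R = i%:R - 1 - j%:R :> rat.
  have ji := ltn_ord j; rewrite natrB; last lia.
  by rewrite -subn1 natrB //; lia.
by apply: vge_le; lra.
Qed.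

Lemma bnd_ps_comp c mu a b : b 0%N = 0 -> bnd c mu a -> bnd (- mu) mu b ->
  bnd c mu (ps_comp a b).
Proof. by move=> b0 ac bm k; apply: bnd_comp; apply: bnd_trunc. Qed.

(* By strong induction: the coefficient of index n of beta(X) - beta(H) is    *)
(* beta_1 (X_n - H_n) up to terms in X_i - H_i for i < n.                     *)
Lemma bnd_ps_comp_inj c mu (z : Zp) (beta X H : nat -> Qp) :
    0 <= c -> z \is a GRing.unit -> beta 1%N = z%:Qp -> bnd (- mu) mu beta ->
    X 0%N = 0 -> H 0%N = 0 -> bnd (- mu) mu H ->
    bnd (c - mu) mu (fun k => ps_comp beta X k - ps_comp beta H k) ->
  bnd (c - mu) mu (fun k => X k - H k).
Proof.
move=> c0 uz beta1 betam X0 H0 Hm bXH; elim/ltn_ind => -[_|n IHn].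
  by rewrite X0 H0 subrr; apply: vge0.
pose P := trunc n.+1 beta; pose K := trunc n.+1 H; pose Q := trunc n.+1 X.
pose E := trunc n (fun k => X k - H k).
have Em : bnd (c - mu) mu (nth 0 E).
  by move=> k; rewrite coef_trunc; case: ifP => [|_]; [apply: IHn | apply: vge0].
have Km : bnd (- mu) mu (nth 0 K) by apply: bnd_trunc.
have Pm : bnd (- mu) mu (nth 0 P) by apply: bnd_trunc.
have KEm : bnd (- mu) mu (nth 0 (K + E)).
  move=> k; rewrite coefD; apply: bndD => //; apply: bnd_le Em; lra.
(* X is split into H, the error [E] in degrees at most n, which the induction controls, and the
   unknown top coefficient. *)
have QE : Q = K + E + (X n.+1 - H n.+1) *: 'X^(n.+1).
  apply/polyP => k; rewrite !coefD coefZ coefXn !coef_trunc.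
  have [k_n|k_n|->] := ltngtP k n.+1; last by rewrite ltnn addr0 mulr1 subrKC.
    by rewrite -ltnS k_n mulr0 addr0 subrKC.
  by rewrite (leqNgt k n) (ltnW k_n) mulr0 !addr0.
have K0 : K`_0 = 0 by rewrite coef_trunc.
have KE0 : (K + E)`_0 = 0 by rewrite coefD !coef_trunc H0 X0 subrr addr0.
have Q0 : Q`_0 = 0 by rewrite coef_trunc.
have split_coef : z%:Qp * (X n.+1 - H n.+1) =
    (ps_comp beta X n.+1 - ps_comp beta H n.+1) - (E * comp_quo P (K + E) K)`_n.+1.
  have -> : E * comp_quo P (K + E) K = (P \Po (K + E)) - (P \Po K).
    by rewrite comp_polyB_quo [K + E - K]addrAC subrr add0r.
  rewrite coefB.
  rewrite /ps_comp -/(trunc n.+1 beta) -/(trunc n.+1 X) -/(trunc n.+1 H) -/P -/Q -/K.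
  rewrite QE coef_comp_addXn // coef_trunc beta1.
  ring.
apply/(vge_unitM _ _ uz); rewrite split_coef.
apply: vgeB; first exact: bXH.
by have := bnd_polyM Em (bnd_comp_quo Pm KEm Km) n.+1; rewrite addr0.
Qed.

(** The equation a(X) = tau is solved degree by degree: each new coefficient of X enters with slope
    a_1 and leaves the lower coefficients of a(X) unchanged. *)
Lemma ps_comp_reversion (a tau : nat -> Qp) : a 0%N = 0 -> a 1%N != 0 -> tau 0%N = 0 ->
  exists2 X : nat -> Qp, X 0%N = 0 & ps_comp a X =1 tau.
Proof.
move=> a0 a1 tau0.
pose next n Q := (tau n.+1 - (trunc n.+1 a \Po Q)`_n.+1) / a 1%N.
pose Q := fix Q n := if n is m.+1 then Q m + next m (Q m) *: 'X^(m.+1) else 0.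
have QS n : Q n.+1 = Q n + next n (Q n) *: 'X^(n.+1) by [].
pose X n := (Q n)`_n.
have QE n : Q n = trunc n X.
  apply/polyP => k; rewrite coef_trunc; elim: n k => [|n IHn] k.
    by case: k => [|k] //; rewrite coef0.
  rewrite QS coefD coefZ coefXn IHn.
  have [k_n|k_n|->] := ltngtP k n.+1.
  - by rewrite mulr0 addr0 -ltnS k_n.
  - by rewrite mulr0 addr0 leqNgt (ltnW k_n).
  - by rewrite ltnn add0r mulr1 /X QS coefD coefZ coefXn eqxx mulr1 IHn ltnn add0r.
have X0 : X 0%N = 0 by rewrite /X coef0.
exists X => // -[|n]; first by rewrite ps_comp_id0 // a0.
rewrite /ps_comp -/(trunc n.+1 a) -/(trunc n.+1 X) -QE QS coef_comp_addXn.
  by rewrite coef_trunc /next divfK // subrKC.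
by rewrite QE coef_trunc.
Qed.

End Composition.

(** * Composites of binomial series through their differential equations *)

Section BinomialComposition.
Context {F : fieldType}.
Implicit Types (a b c d : F) (A H : nat -> F).

(* The recurrences say that A = (1 + c t)^a and H = ((1 + d t)^b - 1) / c;    *)
(* then W = A o H satisfies W(0) = 1 and (1 + d t) W' = d W.                  *)
Lemma comp_binomial a b c d A H : (forall n, n.+1%:R != 0 :> F) -> c != 0 -> a * b = 1 ->
    A 0%N = 1 -> (forall k, k.+1%:R * A k.+1 = (a - k%:R) * c * A k) ->
    H 0%N = 0 -> H 1%N = b * d / c ->
    (forall k, k.+2%:R * H k.+2 = (b - k.+1%:R) * d * H k.+1) ->
  forall n, (trunc n A \Po trunc n H)`_n = (1 + d%:P * 'X)`_n.
Proof.
move=> natr_neq0 c0 ab1 A0 AS H0 H1 HS; pose W n := (trunc n A \Po trunc n H)`_n.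
have WE N n : (n <= N)%N -> (trunc N A \Po trunc N H)`_n = W n.
  move=> nN; apply: (@coef_comp_eq _ n.+1) => // [|i|i]; first by rewrite coef_trunc H0.
    by rewrite !coef_trunc ltnS => i_n; rewrite i_n (leq_trans i_n).
  by rewrite !coef_trunc ltnS => i_n; rewrite i_n (leq_trans i_n).
have W0 : W 0%N = 1.
  rewrite /W -horner_coef0 horner_comp [(trunc 0 H).[0]]horner_coef0 coef_trunc H0.
  by rewrite horner_coef0 coef_trunc.
have WS n : n.+1%:R * W n.+1 + d * n%:R * W n = d * W n.
  pose P := trunc n.+1 A; pose Q := trunc n.+1 H.
  (* [B] and [D] are the defects of the truncations in (1 + c t) A' = a c A and (1 + d t) H' = (b d
     / c) (1 + c H); they vanish through degree n. *)
  pose B := (1 + c%:P * 'X) * P^`() - (a * c)%:P * P.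
  pose D := (1 + d%:P * 'X) * Q^`() - (b * d / c)%:P * (1 + c%:P * Q).
  have Q0 : Q`_0 = 0 by rewrite coef_trunc.
  have coef_lin (e : F) (R : {poly F}) k :
      ((1 + e%:P * 'X) * R^`())`_k = k.+1%:R * R`_k.+1 + e * k%:R * R`_k.
    rewrite mulrDl mul1r coefD coef_deriv -mulrA coefCM coefXM mulr_natl.
    by case: k => [|k] /=; rewrite ?mulr0 ?mul0r // coef_deriv -mulrA mulr_natl.
  have B0 k : (k < n.+1)%N -> B`_k = 0.
    move=> k_n; rewrite coefB coef_lin coefCM !coef_trunc k_n ltnW // AS; ring.
  have D0 k : (k < n.+1)%N -> D`_k = 0.
    move=> k_n; rewrite coefB coef_lin coefCM coefD coefCM !coef_trunc k_n ltnW // coef1.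
    by case: k {k_n} => [|k] /=; [rewrite H0 H1 | rewrite HS]; field.
  (* Chain rule, exact for the truncated polynomials; a b = 1 turns the factor a b d into d. *)
  have E : (1 + d%:P * 'X) * (P \Po Q)^`() - d%:P * (P \Po Q) =
      D * (P^`() \Po Q) + (b * d / c)%:P * (B \Po Q).
    rewrite deriv_comp /B comp_polyB !comp_polyM comp_polyD comp_polyM !comp_polyC.
    rewrite comp_polyX.
    have -> : d%:P * (P \Po Q) = (b * d / c)%:P * ((a * c)%:P * (P \Po Q)).
      rewrite mulrA -polyCM; congr (_%:P * _).
      have -> : b * d / c * (a * c) = (a * b) * d by field.
      by rewrite ab1 mul1r.
    rewrite /D; ring.
  have : ((1 + d%:P * 'X) * (P \Po Q)^`() - d%:P * (P \Po Q))`_n = 0.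
    rewrite E coefD (@coefM_low _ n.+1 D _ D0) // coefCM.
    by rewrite (@coef_comp_low _ n.+1 B Q Q0 B0) // mulr0 addr0.
  rewrite coefB coef_lin coefCM !WE // => /eqP.
  by rewrite subr_eq0 => /eqP.
have W1 : W 1%N = d by have := WS 0%N; rewrite W0 mulr0 mul0r addr0 mul1r mulr1.
(* The recurrence reads (n + 1) W_(n+1) = d (1 - n) W_n, so it stops after W_1. *)
have W2 n : W n.+2 = 0.
  elim: n => [|n IHn].
    apply: (mulfI (natr_neq0 1%N)); rewrite mulr0.
    by apply: (addIr (d * 1%:R * W 1%N)); rewrite WS mulr1 add0r.
  apply: (mulfI (natr_neq0 n.+2)); rewrite mulr0.
  by have := WS n.+2; rewrite IHn !mulr0 addr0.
move=> k; rewrite coefD coef1 coefCM coefX -/(W k).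
by case: k => [|[|k]]; rewrite ?W0 ?W1 ?W2 ?mulr0 ?addr0 // mulr1 add0r.
Qed.

End BinomialComposition.

(** * Valuations of rationals, factorials and binomial coefficients *)

Section Binomial.
Context {p : nat} {p_pr : prime p}.
Local Notation Zp := (padic_int p_pr).
Local Notation Qp := (padic p_pr).
Local Notation "''p'" := (p%:R : Qp).
Implicit Types (a b c d x : Qp) (z : Zp) (y : rat).

Lemma gbinom0 a : gbinom a 0 = 1.
Proof. by rewrite /gbinom big_ord0 fact0 divr1. Qed.

Lemma gbinom1 a : gbinom a 1 = a.
Proof. by rewrite /gbinom big_ord1 subr0 divr1. Qed.

Lemma gbinomS a k : k.+1%:R * gbinom a k.+1 = (a - k%:R) * gbinom a k.
Proof.
have h n : (n.+1%:R : Qp) != 0 by rewrite padic_natr_eq0.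
rewrite /gbinom big_ord_recr /= factS natrM invfM.
have E (F : fieldType) (s t u v : F) : s != 0 -> s * (t * u * (s^-1 * v)) = u * (t * v).
  by move=> s0; field.
exact: E.
Qed.

Lemma ps_comp_binomial a b c d (H : nat -> Qp) : c != 0 -> a * b = 1 ->
    (forall k, H k = c^-1 * (gbinom b k * d ^+ k) - c^-1%:P`_k) ->
  ps_comp (fun k => gbinom a k * c ^+ k) H =1 (fun k => (1 + d%:P * 'X)`_k).
Proof.
move=> c0 ab1 HE; apply: (comp_binomial (b := b) (c := c) _ c0 ab1).
- by move=> n; rewrite padic_natr_eq0.
- by rewrite /= gbinom0 mulr1.
- by move=> k /=; rewrite mulrA gbinomS exprS; ring.
- by rewrite HE gbinom0 coefC !mulr1 subrr.
- by rewrite HE gbinom1 coefC subr0 expr1 mulrC.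
- move=> k; rewrite !HE !coefC !subr0 mulrCA [_ * (gbinom b k.+2 * _)]mulrA gbinomS.
  by rewrite exprS; ring.
Qed.

Lemma padic_intr_eq0 (m : int) : ((m%:~R : Qp) == 0) = (m == 0).
Proof.
case: m => n; rewrite ?NegzE ?mulrNz ?oppr_eq0; first exact: padic_natr_eq0.
by rewrite -[_%:~R]/(n.+1%:R) padic_natr_eq0.
Qed.

(** [ratr] uses the reduced fraction; in characteristic 0 every other representative gives the same
    value. *)
Lemma padic_ratrE y (m n : int) : n != 0 -> y = m%:~R / n%:~R ->
  ratr y = m%:~R / n%:~R :> Qp.
Proof.
move=> n0 yE; rewrite /ratr; apply/eqP; rewrite eqr_div ?padic_intr_eq0 ?denq_neq0 //.
rewrite -!intrM; apply/eqP; congr _%:~R; apply/eqP.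
rewrite -(eqr_int rat) !intrM -eqr_div ?intr_eq0 ?denq_neq0 //.
by rewrite divq_num_den yE.
Qed.

Lemma padic_ratrN y : ratr (- y) = - ratr y :> Qp.
Proof. by rewrite /ratr numqN denqN mulrNz mulNr. Qed.

Lemma padic_ratrV y : y != 0 -> ratr y^-1 = (ratr y)^-1 :> Qp.
Proof.
move=> y0; rewrite [in RHS]/ratr invf_div; apply: padic_ratrE; first by rewrite numq_eq0.
by rewrite -{1}[y]divq_num_den invf_div.
Qed.

Lemma padic_natr_decomp n : (0 < n)%N ->
  exists2 z, z \is a GRing.unit & n%:R = 'p ^ (logn p n) * z%:Qp.
Proof.
move=> n0; have [m pm nE] := pfactor_coprime p_pr n0; exists m%:R.
  apply/padic_int_unitP; rewrite residue_nat expn1 => /eqP; rewrite -[_ == _]/(p %| m)%N.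
  by apply/negP; rewrite -prime_coprime.
by rewrite rmorph_nat -exprnP -natrX -natrM mulnC -nE.
Qed.

Lemma padic_ratr_decomp y : 0 < y ->
  exists2 z, z \is a GRing.unit & ratr y = 'p ^ rat_ord p y * z%:Qp.
Proof.
move=> y0.
have [a ua aE] : exists2 z, z \is a GRing.unit &
    (numq y)%:~R = 'p ^ (logn p `|numq y|) * z%:Qp.
  have n0 : (0 < `|numq y|)%N by rewrite absz_gt0 numq_eq0 gt_eqF.
  have [z uz zE] := padic_natr_decomp n0; exists z => //; rewrite -zE.
  by rewrite -[in LHS](gez0_abs (_ : 0 <= numq y)) // numq_ge0 ltW.
have [b ub bE] : exists2 z, z \is a GRing.unit &
    (denq y)%:~R = 'p ^ (logn p `|denq y|) * z%:Qp.
  have n0 : (0 < `|denq y|)%N by rewrite absz_gt0 denq_neq0.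
  have [z uz zE] := padic_natr_decomp n0; exists z => //; rewrite -zE.
  by rewrite -[in LHS](gez0_abs (_ : 0 <= denq y)).
exists (a / b); first by rewrite rpredM ?rpredV.
rewrite /ratr /rat_ord aE bE rmorphM rmorphV // invfM mulrACA.
by rewrite expfzDr ?padic_p_neq0 // -invr_expz.
Qed.

Lemma logn_fact_le n : (0 < n)%N -> (p.-1 * logn p n`! < n)%N.
Proof.
move=> n0; have p1 := prime_gt1 p_pr.
(* Partial sums of Legendre's formula: p - 1 copies of the next quotient plus that quotient fit into
   the previous one. The maximum with 1 makes the final inequality strict. *)
have h m : (p.-1 * (\sum_(1 <= k < m.+1) n %/ p ^ k) + maxn 1 (n %/ p ^ m) <= n)%N.
  elim: m => [|m IHm]; first by rewrite big_geq // expn0 divn1; lia.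
  apply: leq_trans IHm; rewrite big_nat_recr //= expnSr divnMA.
  have := leq_divM (n %/ p ^ m) p; set q := (n %/ p ^ m)%N; set q' := (q %/ p)%N.
  set S := (\sum_(1 <= k < m.+1) n %/ p ^ k)%N.
  move=> qq'; rewrite mulnDr -addnA leq_add2l.
  case: q' qq' => [|q'] qq'; nia.
by rewrite logn_fact //; have := h n; lia.
Qed.

Lemma vge_invfact k : vge (- (k.-1%:R * rho p)) (k`!%:R^-1 : Qp).
Proof.
have [z uz ->] := padic_natr_decomp (fact_gt0 k).
rewrite invfM [_^-1 * _]mulrC -(rmorphV (@padic_of_int p p_pr) uz).
have uz' : z^-1 \is a GRing.unit by rewrite unitrV.
apply/(vge_unitM _ _ uz').
rewrite invr_expz; apply: (vge_le _ (vge_exp _)); rewrite rmorphN lerN2 /=.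
have p1 : 0 < p%:R - 1 :> rat by rewrite subr_gt0 ltr1n prime_gt1.
rewrite /rho ler_pdivlMr // -[1]/(1%:R) -natrB ?prime_gt0 // -natrM ler_nat.
case: k {uz} => [|k]; first by rewrite fact0 logn1.
by have := @logn_fact_le k.+1 isT; lia.
Qed.

(** Replace z by a natural number r congruent to it modulo p^N, with N = ord k!. The numerator
    changes by a multiple of p^N, so the quotient differs from 'C(r, k) by a p-adic integer. *)
Lemma vge_gbinom z k : vge 0 (gbinom z%:Qp k).
Proof.
pose N := logn p k`!; have [z' zE] := padic_int_approx z N; set r := residue z N in zE.
have prodE m : exists v, \prod_(i < m) (z%:Qp - i%:R) = (r ^_ m)%:R + 'p ^ N * v%:Qp.
  elim: m => [|m [v vE]].
    by exists 0; rewrite big_ord0 ffactn0 rmorph0 mulr0 addr0.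
  exists (z' * (r ^_ m)%:R + v * (z - m%:R)).
  rewrite big_ord_recr /= vE ffactnSr natrM.
  (* Where the natural subtraction truncates, the falling factorial is already 0. *)
  have -> : (r ^_ m)%:R * (r - m)%:R = (r ^_ m)%:R * (r%:R - m%:R) :> Qp.
    have [mr|rm] := leqP m r; first by rewrite natrB.
    by rewrite ffact_small // !mul0r.
  have -> : (z' * (r ^_ m)%:R + v * (z - m%:R))%:Qp =
      z'%:Qp * (r ^_ m)%:R + v%:Qp * (z%:Qp - m%:R).
    by rewrite rmorphD !rmorphM rmorphB !rmorph_nat.
  have -> : z%:Qp = r%:R + 'p ^ N * z'%:Qp.
    by rewrite zE rmorphD rmorphM rmorphXn !rmorph_nat.
  ring.
have [v vE] := prodE k; have [b ub bE] := padic_natr_decomp (fact_gt0 k).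
have f0 : k`!%:R != 0 :> Qp by rewrite padic_natr_eq0 -lt0n fact_gt0.
have -> : gbinom z%:Qp k = 'C(r, k)%:R + (v * b^-1)%:Qp.
  rewrite /gbinom vE -bin_ffact natrM mulrDl mulfK //; congr (_ + _).
  rewrite bE invfM rmorphM rmorphV // mulrACA divff ?mul1r //.
  exact: padic_pX_neq0.
by apply: vgeD; [apply: vge_natr | apply: vge_of_int].
Qed.

(* For ord y = 0 the binomial coefficients are integral, otherwise the        *)
(* denominator k! costs at most (k-1)/(p-1).                                  *)
Lemma vge_binomial_coef y x (kappa : nat) (e e' : int) (omega : Zp) k : 0 < y ->
    e = iota_p p y + kappa%:Z -> e' = iota'_p p y + kappa%:Z ->
    x = ratr y \/ x = - ratr y ->
  vge (e'%:~R + k%:R * (kappa%:R - rho_at p y))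
    (gbinom x k.+1 * ('p ^ e * omega%:Qp) ^+ k.+1).
Proof.
move=> y0 eE e'E xE; have [z0 uz0 yE] := padic_ratr_decomp y0.
have {z0 uz0 yE xE} [z xE] : exists z, x = 'p ^ rat_ord p y * z%:Qp.
  by case: xE => ->; [exists z0 | exists (- z0)]; rewrite ?rmorphN ?mulrN yE.
rewrite exprMn mulrA -[e'%:~R + _]addr0.
apply: vgeM; last by rewrite -rmorphXn; apply: vge_of_int.
move: xE eE e'E; rewrite /rho_at /iota_p /iota'_p; case: eqVneq => [->|o0] xE eE e'E.
  have -> : x = z%:Qp by rewrite xE expr0z mul1r.
  have [-> ->] : e = kappa /\ e' = kappa by split; rewrite ?eE ?e'E ?oppr0 maxxx add0r.
  rewrite -[X in vge X]add0r; apply: vgeM; first exact: vge_gbinom.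
  have := vgeX k.+1 (vge_exp (p_pr := p_pr) kappa); apply: vge_le.
  by rewrite subr0 -addn1 natrD mulrDl mul1r addrC.
(* The factor x p^e supplies e', since ord y + e = e'; each of the k other factors supplies kappa,
   since e and e' are at least kappa; the factorial costs k rho_p. *)
have -> : gbinom x k.+1 * ('p ^ e) ^+ k.+1 =
    (x * 'p ^ e) * (\prod_(i < k) ((x - i.+1%:R) * 'p ^ e)) * (k.+1)`!%:R^-1.
  rewrite /gbinom big_ord_recl subr0 big_split /= prodr_const card_ord exprS.
  by ring.
have -> : e'%:~R + k%:R * (kappa%:R - rho p) =
   (e'%:~R + k%:R * kappa%:R) + - (k.+1.-1%:R * rho p) by rewrite /=; ring.
have xe : vge e'%:~R (x * 'p ^ e).
  rewrite xE mulrAC -expfzDr ?padic_p_neq0 //.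
  have -> : rat_ord p y + e = e' by rewrite eE e'E; lia.
  by rewrite -[e'%:~R]addr0; apply: vgeM; [apply: vge_exp | apply: vge_of_int].
apply: vgeM; last exact: vge_invfact.
apply: vgeM => //.
elim: k => [|k IHk]; first by rewrite big_ord0 mul0r; apply: (vge_natr 1).
rewrite big_ord_recr /= -addn1 natrD mulrDl mul1r; apply: vgeM => //.
rewrite mulrBl; apply: vgeB; first by apply: vge_le xe; rewrite pmulrn e'E ler_int; lia.
rewrite -[kappa%:R]add0r; apply: vgeM; first exact: vge_natr.
by apply: vge_le (vge_exp e); rewrite pmulrn eE ler_int; lia.
Qed.

End Binomial.

(** * Convergence and evaluation on Z_p *)

Section Evaluation.
Context {p : nat} {p_pr : prime p}.
Local Notation Zp := (padic_int p_pr).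
Local Notation Qp := (padic p_pr).
Local Notation "''p'" := (p%:R : Qp).
Implicit Types (a b : nat -> Qp) (x v : Qp) (z : Zp) (c d r mu : rat).

Lemma exists_mul_ge mu c : 0 < mu ->
  exists N : nat, forall n, (N <= n)%N -> c <= n%:R * mu.
Proof.
move=> mu0; exists (Num.bound (`|c| / mu)) => n Nn.
apply: le_trans (ler_norm _) _; rewrite -ler_pdivrMr //.
apply: (@le_trans _ _ (Num.bound (`|c| / mu))%:R); last by rewrite ler_nat.
by apply/ltW/archi_boundP; rewrite divr_ge0 // ltW.
Qed.

Definition psum a x n : Qp := \sum_(k < n) a k * x ^+ k.

Lemma vgeX0 x k : vge 0 x -> vge 0 (x ^+ k).
Proof. by move=> /(vgeX k); rewrite mulr0. Qed.

Lemma vge_tail r mu a x m n : bnd r mu a -> vge 0 x -> 0 <= mu -> (m <= n)%N ->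
  vge (r + m%:R * mu) (psum a x n - psum a x m).
Proof.
move=> amu x0 mu0 mn; rewrite /psum -!(big_mkord xpredT (fun k => a k * x ^+ k)).
rewrite (big_cat_nat (n := m)) //= addrAC subrr add0r big_nat.
apply: vge_sum => k /andP[mk _]; rewrite -[X in vge X]addr0; apply: vgeM (vgeX0 _ x0).
by apply: vge_le (amu k); rewrite lerD2l ler_wpM2r // ler_nat.
Qed.

Lemma vge_tail_min r mu a x K m n : bnd r mu a -> vge 0 x -> 0 <= mu ->
  (K <= n)%N -> (K <= m)%N -> vge (r + K%:R * mu) (psum a x n - psum a x m).
Proof.
move=> amu x0 mu0 Kn Km; rewrite -[_ - _](subrKA (psum a x K)).
apply: vgeD; first exact: vge_tail.
by rewrite -opprB; apply/vgeN/vge_tail.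
Qed.

Lemma exists_psum_limit mu a x : 0 < mu -> bnd 0 mu a -> vge 0 x ->
  exists v, forall n, vge (n%:R * mu) (v - psum a x n).
Proof.
move=> mu0 amu x0; have mu_ge0 := ltW mu0.
(* From index [N j] on, the partial sums agree modulo p^j, so completeness of Z_p applies to this
   subsequence. *)
pose N (j : nat) := Num.bound (j%:R / mu).
have NP j : j%:R < (N j)%:R * mu.
  by rewrite -ltr_pdivrMr //; apply: archi_boundP; rewrite divr_ge0.
have psum_int n : vge 0 (psum a x n).
  apply: vge_sum => k _; rewrite -[0]addr0; apply: vgeM (vgeX0 _ x0).
  by apply: vge_le (amu k); rewrite add0r mulr_ge0.
have /choice[s sE] : forall j, exists z, psum a x (N j) = z%:Qp.
  by move=> j; apply/padic_integralP.
have [j|l lP] := padic_int_complete (s := s).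
  have : vge j%:~R (psum a x (N j.+1) - psum a x (N j)).
    pose K := minn (N j.+1) (N j).
    apply: (@vge_le _ _ _ (0 + K%:R * mu)); last first.
      by apply: vge_tail_min; rewrite ?geq_minl ?geq_minr.
    rewrite add0r /K /minn; case: ifP => _; apply/ltW; last exact: NP.
    by apply: le_lt_trans (NP _); rewrite ler_nat.
  rewrite !sE -rmorphB => /vge_expP[z zE]; exists z; apply: padic_of_int_inj.
  by rewrite zE rmorphM rmorphXn rmorph_nat.
exists l%:Qp => n; pose j := Num.bound (n%:R * mu).
have jn : n%:R * mu < j%:R by apply: archi_boundP; rewrite mulr_ge0.
have nN : (n <= N j)%N.
  rewrite -(ler_nat rat) -(ler_pM2r mu0); apply/ltW/(lt_trans jn); exact: NP.
rewrite -[_ - _](subrKA (psum a x (N j))); apply: vgeD; last first.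
  by rewrite -[_ * mu]add0r; apply: vge_tail.
apply: (@vge_le _ _ _ j%:~R); first exact: ltW.
have [z zE] := lP j; apply/vge_expP; exists z; rewrite sE -rmorphB zE.
by rewrite rmorphM rmorphXn rmorph_nat.
Qed.

Lemma exists_ps_limit r mu a x : 0 < mu -> bnd r mu a -> vge 0 x ->
  exists v, forall n, vge (r + n%:R * mu) (v - psum a x n).
Proof.
move=> mu0 amu x0; pose j := Num.floor r; pose b k := 'p ^ (- j) * a k.
have bmu : bnd 0 mu b.
  move=> k; apply/vge_expM; apply: vge_le (amu k).
  by rewrite rmorphN /= opprK addrC addrA addr0 lerD2r floor_le.
have aE n : psum a x n = 'p ^ j * psum b x n.
  rewrite mulr_sumr; apply: eq_bigr => k _.
  by rewrite mulrA mulrA -expfzDr ?padic_p_neq0 // subrr mul1r.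
have [v vP] := exists_psum_limit mu0 bmu x0; exists ('p ^ j * v) => n.
(* Rescaling by p^(floor r) loses the fractional part of r. Passing through a later partial sum
   restores the rate r + n mu. *)
have [N NP] := exists_mul_ge (r + n%:R * mu - j%:~R) mu0.
rewrite -[_ - _](subrKA (psum a x (maxn n N))); apply: vgeD; last first.
  by apply: vge_tail => //; [apply: ltW | apply: leq_maxl].
by rewrite aE -mulrBr; apply/vge_expM/(vge_le _ (vP _))/NP/leq_maxr.
Qed.

Lemma padic_cvg_unique (s : nat -> Qp) v v' : padic_cvg s v -> padic_cvg s v' -> v = v'.
Proof.
move=> /padic_cvgP sv /padic_cvgP sv'; apply/eqP; rewrite -subr_eq0; apply/eqP.
apply: vge_all_eq0 => j; have [N NP] := sv j; have [N' NP'] := sv' j.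
rewrite -[_ - _](subrKA (s (maxn N N'))); apply: vgeD.
  by rewrite -opprB; apply/vgeN/NP; rewrite leq_maxl.
by apply: NP'; rewrite leq_maxr.
Qed.

Lemma padic_cvg_rate r mu (s : nat -> Qp) v : 0 < mu ->
  (forall n, vge (r + n%:R * mu) (v - s n)) -> padic_cvg s v.
Proof.
move=> mu0 vP; apply/padic_cvgP => j.
have [N NP] := exists_mul_ge (j%:~R - r) mu0; exists N => n Nn.
by rewrite -opprB; apply/vgeN/(vge_le _ (vP n)); rewrite -lerBlDl NP.
Qed.

Lemma ps_eval_eq r mu a x v : 0 < mu ->
  (forall n, vge (r + n%:R * mu) (v - psum a x n)) -> ps_eval a x = v.
Proof.
move=> mu0 vP; have cv := padic_cvg_rate mu0 vP.
exact: padic_cvg_unique (xgetPex 0 (ex_intro _ v cv)) cv.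
Qed.

Lemma ps_eval_approx r mu a x n : 0 < mu -> bnd r mu a -> vge 0 x ->
  vge (r + n%:R * mu) (ps_eval a x - psum a x n).
Proof.
move=> mu0 amu x0; have [v vP] := exists_ps_limit mu0 amu x0.
by rewrite (ps_eval_eq mu0 vP).
Qed.

Lemma ps_evalZ r mu e a x : 0 < mu -> bnd r mu a -> vge 0 x ->
  ps_eval (fun k => e * a k) x = e * ps_eval a x.
Proof.
move=> mu0 amu x0.
have [s es] : exists s, vge s e.
  have [->|e0] := eqVneq e 0; first by exists 0; apply: vge0.
  have [j [z _ [-> _]]] := padic_decomp e0; exists (j%:~R + 0).
  by apply: vgeM; [apply: vge_exp | apply: vge_of_int].
apply: (@ps_eval_eq (s + r) mu) => // n; rewrite -addrA.
have -> : psum (fun k => e * a k) x n = e * psum a x n.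
  by rewrite mulr_sumr; apply: eq_bigr => k _; rewrite mulrA.
by rewrite -mulrBr; apply: vgeM => //; apply: ps_eval_approx.
Qed.

Lemma ps_eval0 r mu a : 0 < mu -> bnd r mu a -> ps_eval a 0 = a 0%N.
Proof.
move=> mu0 amu; apply: (@ps_eval_eq r mu) => // -[|n].
  by rewrite /psum big_ord0 subr0; apply: amu.
rewrite /psum big_ord_recl mulr1 big1 ?addr0 ?subrr; first exact: vge0.
by move=> k _; rewrite exprS mul0r mulr0.
Qed.

(** The divided difference of a partial sum on Z_p is a_1 up to an error bounded by the higher
    coefficients. *)
Lemma psumB_factor r a x x' n : vge 0 x -> vge 0 x' -> (forall k, vge r (a k.+2)) ->
  exists2 d, vge r (d - a 1%N) & psum a x n.+2 - psum a x' n.+2 = (x - x') * d.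
Proof.
move=> x0 x'0 ar.
exists (a 1%N + \sum_(k < n) a k.+2 * \sum_(i < k.+2) x ^+ (k.+1 - i) * x' ^+ i).
  rewrite addrAC subrr add0r; apply: vge_sum => k _; rewrite -[r]addr0; apply: vgeM => //.
  by apply: vge_sum => i _; rewrite -[0]addr0; apply: vgeM; apply: vgeX0.
rewrite -sumrB !big_ord_recl !expr0 subrr add0r [RHS]mulrDr.
congr (_ + _); first by rewrite !expr1 -mulrBr mulrC.
rewrite mulr_sumr; apply: eq_bigr => k _.
by rewrite -mulrBr subrXX mulrCA.
Qed.

Lemma vge_ps_eval mu a x : 0 < mu -> a 0%N = 0 -> bnd (- mu) mu a -> vge 0 x ->
  vge 0 (ps_eval a x).
Proof.
move=> mu0 a0 amu x0; have := ps_eval_approx 1 mu0 amu x0.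
by rewrite /psum big_ord1 a0 mul0r subr0 mul1r addNr.
Qed.

(** Both sides are compared with truncations, for which substitution is polynomial composition.
    Every error has valuation at least c + n mu, and n is arbitrary. *)
Lemma ps_eval_comp c mu a b x : 0 < mu -> bnd c mu a -> b 0%N = 0 ->
    bnd (- mu) mu b -> vge 0 x ->
  ps_eval a (ps_eval b x) = ps_eval (ps_comp a b) x.
Proof.
move=> mu0 ac b0 bmu x0; apply/eqP; rewrite -subr_eq0; apply/eqP.
set v := ps_eval b x; have v0 : vge 0 v by apply: vge_ps_eval bmu x0.
have cmp_bnd : bnd c mu (ps_comp a b) by apply: bnd_ps_comp.
suff h n : vge (c + n%:R * mu) (ps_eval a v - ps_eval (ps_comp a b) x).
  apply: vge_all_eq0 => j; have [n nP] := exists_mul_ge (j%:~R - c) mu0.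
  by apply: vge_le (h n); rewrite -lerBlDl nP.
have le_c (k : nat) : c <= c + k%:R * mu by rewrite lerDl mulr_ge0 // ltW.
have le_n (k : nat) : (n <= k)%N -> c + n%:R * mu <= c + k%:R * mu.
  by move=> nk; rewrite lerD2l ler_wpM2r ?ler_nat // ltW.
pose P := trunc n.+1 a; pose Q := trunc n.+1 b.
have hornerE (e : nat -> Qp) u : (trunc n.+1 e).[u] = psum e u n.+2.
  by rewrite horner_poly.
pose w := Q.[x]; have w0 : vge 0 w.
  rewrite /w hornerE; apply: vge_sum => -[[|k] _] _ /=; first by rewrite b0 mul0r; apply: vge0.
  rewrite -[0]addr0; apply: vgeM (vgeX0 _ x0); apply: vge_le (bmu k.+1).
  by rewrite -addn1 natrD mulrDl mul1r addrC addrK mulr_ge0 // ltW.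
rewrite -[_ - _](subrKA (psum a v n.+2)); apply: vgeD.
  by apply: vge_le (ps_eval_approx n.+2 mu0 ac v0); apply: le_n; rewrite leqW.
rewrite -[_ - _](subrKA (psum a w n.+2)); apply: vgeD.
  have [k|d da ->] := @psumB_factor c a v w n v0 w0; first exact: vge_le (ac _).
  rewrite [c + _]addrC; apply: vgeM.
    rewrite /w hornerE; apply: vge_le (ps_eval_approx n.+2 mu0 bmu x0).
    by rewrite -addn2 natrD; lra.
  by apply/(vge_congr da)/(vge_le _ (ac 1%N)).
rewrite -[_ - _](subrKA (psum (ps_comp a b) x n.+2)); apply: vgeD; last first.
  rewrite -opprB; apply/vgeN/(vge_le _ (ps_eval_approx n.+2 mu0 cmp_bnd x0)).
  by apply: le_n; rewrite leqW.
rewrite -!hornerE -/P /w -horner_comp -hornerN -hornerD.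
(* The truncated composite has the right coefficients up to degree n + 1; its spurious higher ones
   are small by [bnd_comp]. *)
set R := _ - _; have RP k : vge (c + n%:R * mu) R`_k.
  rewrite coefB coef_trunc; case: leqP => [k_n|n_k].
    by rewrite coef_comp_trunc // subrr; apply: vge0.
  rewrite subr0; apply: vge_le (_ : vge (c + k%:R * mu) _); first by apply: le_n; lia.
  by apply: bnd_comp; apply: bnd_trunc.
rewrite horner_coef; apply: vge_sum => k _; rewrite -[X in vge X]addr0.
exact: vgeM (vgeX0 _ x0).
Qed.

End Evaluation.

(** * Inversion of perturbed series and of the binomial series *)

Section Inversion.
Context {p : nat} {p_pr : prime p}.
Local Notation Zp := (padic_int p_pr).
Local Notation Qp := (padic p_pr).
Local Notation "''p'" := (p%:R : Qp).
Implicit Types (a b X : nat -> Qp) (x : Qp) (z : Zp) (c d r mu : rat).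

Lemma ps_comp_comb (s t c : Qp) a b (d : nat -> Qp) X :
    (forall k, a k = s * b k + t * d k + c%:P`_k) ->
  forall k, ps_comp a X k = s * ps_comp b X k + t * ps_comp d X k + c%:P`_k.
Proof.
move=> abc k; rewrite /ps_comp.
have linE (F : fieldType) (A B R : {poly F}) v v' v'' :
    ((v *: A + v' *: B + v''%:P) \Po R)`_k =
    v * (A \Po R)`_k + v' * (B \Po R)`_k + v''%:P`_k.
  by rewrite !comp_polyD !comp_polyZ comp_polyC !coefD !coefZ.
have -> : \poly_(i < k.+1) a i =
    s *: \poly_(i < k.+1) b i + t *: \poly_(i < k.+1) d i + c%:P.
  apply/polyP => i; rewrite !coefD !coefZ !coef_poly; case: ltnP => // ki.
  by rewrite !mulr0 !add0r coefC; case: i ki.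
exact: linE.
Qed.

Lemma ps_comp_affine (s c : Qp) a b X :
    (forall k, a k = s * b k + c%:P`_k) ->
  forall k, ps_comp a X k = s * ps_comp b X k + c%:P`_k.
Proof.
move=> abc k; rewrite (@ps_comp_comb s 0 c a b b) => [|i]; first by rewrite mul0r addr0.
by rewrite mul0r addr0.
Qed.

Lemma ps_comp0r a k : ps_comp a (fun=> 0) k = (a 0%N)%:P`_k.
Proof.
rewrite /ps_comp (_ : \poly_(i < k.+1) 0 = 0) ?comp_poly0r ?coef_poly //.
by apply/polyP => i; rewrite coef_poly coef0 if_same.
Qed.

(** This is [bnd_ps_comp_inj] against the zero series; it bounds an inverse without computing its
    coefficients. *)
Lemma bnd_of_ps_comp mu z a X : z \is a GRing.unit -> a 0%N = 0 -> a 1%N = z%:Qp ->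
    bnd (- mu) mu a -> X 0%N = 0 -> bnd (- mu) mu (ps_comp a X) -> bnd (- mu) mu X.
Proof.
move=> uz a0 a1 amu X0 aX k.
have := @bnd_ps_comp_inj _ p_pr 0 mu z a X (fun=> 0) (lexx 0) uz a1 amu X0 erefl.
rewrite sub0r => /(_ _ _ k); rewrite subr0; apply=> i; first exact: vge0.
by rewrite ps_comp0r a0 coef0 subr0.
Qed.

Lemma In0w_bnd mu X : 0 < mu -> X 0%N = 0 -> bnd (- mu) mu X -> In0w mu X.
Proof.
move=> mu0 X0 Xmu; exists (fun k => X k.+1); last by case.
have XS k : vge (k%:R * mu) (X k.+1).
  by apply: vge_le (Xmu k.+1); rewrite -addn1 natrD; lra.
split=> [|k]; last exact/padic_ordP.
split=> [k|]; first by apply/padic_integralP/(vge_le _ (XS k)); rewrite mulr_ge0 // ltW.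
apply: (@padic_cvg_rate _ _ 0 mu) => // n.
by rewrite add0r sub0r; apply: vgeN.
Qed.

(** The divided difference of a is p^e times a unit: its linear part is p^e z, and the rest has
    valuation at least e + mu > e, hence at least e + 1. *)
Lemma ps_eval_congr (e : int) mu z a (j : int) x x' : 0 < mu -> z \is a GRing.unit ->
    a 1%N = 'p ^ e * z%:Qp -> (forall k, vge (e%:~R + k%:R * mu) (a k.+1)) ->
    bnd (- mu) mu a -> vge 0 x -> vge 0 x' ->
  vge j%:~R (ps_eval a x - ps_eval a x') <-> vge (j - e)%:~R (x - x').
Proof.
move=> mu0 uz a1 aS amu x0 x'0.
have [n nP] := exists_mul_ge (j%:~R + mu) mu0.
have jn : j%:~R <= - mu + n.+2%:R * mu by have := nP n.+2 (leqW (leqnSn n)); lra.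
have near v : vge 0 v -> vge j%:~R (ps_eval a v - psum a v n.+2).
  by move=> v0; apply: vge_le jn (ps_eval_approx n.+2 mu0 amu v0).
have diff : vge j%:~R (ps_eval a x - ps_eval a x' - (psum a x n.+2 - psum a x' n.+2)).
  rewrite opprB [X in _ + X]addrC addrACA [X in _ + X]addrC -[X in _ + X]opprB.
  by apply: vgeB; apply: near.
apply: (iff_trans (vge_congr diff)).
have [k|d da ->] := @psumB_factor p p_pr (e%:~R + mu) a x x' n x0 x'0.
  by apply: vge_le (aS k.+1); rewrite lerD2l -addn1 natrD mulrDl mul1r lerDr mulr_ge0 // ltW.
have [v vE] : exists v, d - a 1%N = 'p ^ (e + 1) * v%:Qp.
  apply/vge_expP; move/vge_ceilP: da; apply: vge_le; rewrite ler_int.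
  by rewrite lezD1 ceil_gt_int ltrDl.
have dE : d = 'p ^ e * (z + p%:R * v)%:Qp.
  rewrite -(subrK (a 1%N) d) vE a1 rmorphD rmorphM rmorph_nat expfzDr ?padic_p_neq0 //.
  by rewrite expr1z; ring.
rewrite dE mulrCA [(x - x') * _]mulrC vge_expM -rmorphB.
exact: vge_unitM (padic_int_unitD v uz).
Qed.

(** Dividing a - a_0 by p^e leaves a series with unit linear coefficient, whose reversion is taken
    at z' t. *)
Lemma ps_comp_solve (e : int) mu z z' a : 0 < mu -> z \is a GRing.unit ->
    a 1%N = 'p ^ e * z%:Qp -> (forall k, vge (e%:~R + k%:R * mu) (a k.+1)) ->
  exists X, [/\ X 0%N = 0, bnd (- mu) mu X &
    forall k, ps_comp a X k = ((a 0%N)%:P + ('p ^ e * z'%:Qp)%:P * 'X)`_k].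
Proof.
move=> mu0 uz a1 aS.
pose b k := 'p ^ (- e) * (a k - (a 0%N)%:P`_k).
have b0 : b 0%N = 0 by rewrite /b coefC subrr mulr0.
have b1 : b 1%N = z%:Qp.
  by rewrite /b coefC subr0 a1 mulrA -expfzDr ?padic_p_neq0 // addNr mul1r.
have bmu : bnd (- mu) mu b.
  case=> [|k]; first by rewrite b0; apply: vge0.
  rewrite /b coefC subr0; apply/vge_expM; apply: vge_le (aS k).
  by rewrite -addn1 natrD rmorphN /=; lra.
have b1_neq0 : b 1%N != 0.
  by rewrite b1 padic_of_int_eq0; apply: contraTneq uz => ->; rewrite unitr0.
pose tau k := (z'%:Qp%:P * 'X)`_k.
have tau0 : tau 0%N = 0 by rewrite /tau coefCM coefX mulr0.
have [X X0 XE] := ps_comp_reversion b0 b1_neq0 tau0.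
exists X; split=> //.
  apply: bnd_of_ps_comp b1 bmu X0 _ => // k; rewrite XE /tau coefCM coefX.
  case: k => [|[|k]]; rewrite ?mulr0; [exact: vge0 | | exact: vge0].
  by rewrite mulr1 mul1r addNr; apply: vge_of_int.
move=> k; rewrite (@ps_comp_affine ('p ^ e) (a 0%N) a b) => [|i].
  by rewrite XE /tau coefD addrC polyCM -mulrA !coefCM.
by rewrite /b mulrA -expfzDr ?padic_p_neq0 // subrr mul1r subrK.
Qed.

(** The linear coefficient of beta is a unit because ord y + e = e'. The bound on H is deduced from
    the bound on beta and beta(H) = t. *)
Lemma binomial_reversion (y mu : rat) (kappa : nat) (e e' : int) (omega : Zp)
    (b beta H : nat -> Qp) :
    0 < y -> e = iota_p p y + kappa%:Z -> e' = iota'_p p y + kappa%:Z ->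
    omega \is a GRing.unit -> mu <= kappa%:R - rho_at p y ->
    b = binomial_ps (- y) ('p ^ e * omega%:Qp) ->
    (forall k, beta k = 'p ^ (- e') * (b k - 1%:P`_k)) ->
    (forall k, H k = 'p ^ (- e) * omega%:Qp^-1 * binomial_ps (- y^-1) ('p ^ e') k
                     - ('p ^ (- e) * omega%:Qp^-1)%:P`_k) ->
  [/\ exists2 z, z \is a GRing.unit & beta 1%N = z%:Qp, bnd (- mu) mu beta,
      H 0%N = 0, bnd (- mu) mu H & ps_comp beta H =1 (fun k => 'X`_k)].
Proof.
move=> y0 eE e'E uomega mu_le bE betaE HE.
have [z uz yE] := padic_ratr_decomp (p_pr := p_pr) y0.
have omega0 : omega%:Qp != 0.
  by rewrite padic_of_int_eq0; apply: contraTneq uomega => ->; rewrite unitr0.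
have ratr0 : ratr y != 0 :> Qp.
  rewrite yE mulf_neq0 ?padic_pX_neq0 // padic_of_int_eq0.
  by apply: contraTneq uz => ->; rewrite unitr0.
have b0 : b 0%N = 1 by rewrite bE /binomial_ps gbinom0 mulr1.
have beta0 : beta 0%N = 0 by rewrite betaE b0 coefC subrr mulr0.
have beta1 : beta 1%N = (- (z * omega))%:Qp.
  rewrite betaE bE /binomial_ps gbinom1 coefC subr0 padic_ratrN yE expr1.
  have -> : 'p ^ (- e') * (- ('p ^ rat_ord p y * z%:Qp) * ('p ^ e * omega%:Qp)) =
      'p ^ (- e') * ('p ^ rat_ord p y * 'p ^ e) * - (z%:Qp * omega%:Qp) by ring.
  rewrite -!expfzDr ?padic_p_neq0 // rmorphN rmorphM.
  have -> : - e' + (rat_ord p y + e) = 0 by rewrite e'E eE /iota_p /iota'_p; lia.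
  by rewrite mul1r.
have ubeta : - (z * omega) \is a GRing.unit by rewrite unitrN unitrM uz.
have betamu : bnd (- mu) mu beta.
  case=> [|k]; first by rewrite beta0; apply: vge0.
  rewrite betaE coefC subr0; apply/vge_expM.
  have := vge_binomial_coef (p_pr := p_pr) omega k y0 eE e'E (or_intror (padic_ratrN y)).
  rewrite bE; apply: vge_le; rewrite rmorphN /= -addn1 natrD.
  have := ler_wpM2l (ler0n rat k) mu_le; lra.
have e_neq0 : 'p ^ e * omega%:Qp != 0 by rewrite mulf_neq0 ?padic_pX_neq0.
have eV : ('p ^ e * omega%:Qp)^-1 = 'p ^ (- e) * omega%:Qp^-1 by rewrite invfM invr_expz.
have bH : ps_comp b H =1 (fun k => (1 + ('p ^ e')%:P * 'X)`_k).
  rewrite bE; apply: (ps_comp_binomial e_neq0 (b := ratr (- y^-1))).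
    by rewrite !padic_ratrN padic_ratrV ?gt_eqF // mulrNN divff.
  by move=> k; rewrite HE eV.
have linE (F : fieldType) (s d : F) k : s * d = 1 ->
    s * (1 + d%:P * 'X)`_k + (- s)%:P`_k = 'X`_k.
  move=> sd; rewrite coefD coef1 coefCM coefX coefC.
  by case: k => [|[|k]] /=; rewrite ?(mulr0, mulr1, addr0, add0r) ?subrr.
have cstE (F : fieldType) (s v : F) k : s * (v - 1%:P`_k) = s * v + (- s)%:P`_k.
  by rewrite mulrBr !coefC; case: ifP => _; rewrite ?mulr1 // mulr0 oppr0.
have betaH k : ps_comp beta H k = 'X`_k.
  rewrite (@ps_comp_affine ('p ^ (- e')) (- 'p ^ (- e')) beta b) => [|i].
    rewrite bH; apply: linE.
    by rewrite -expfzDr ?padic_p_neq0 // addNr.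
  by rewrite betaE; apply: cstE.
have H0 : H 0%N = 0.
  by rewrite HE /binomial_ps gbinom0 coefC !mulr1 subrr.
split=> //; first by exists (- (z * omega)).
apply: bnd_of_ps_comp ubeta beta0 beta1 betamu H0 _ => k.
rewrite betaH coefX; case: k => [|[|k]]; [exact: vge0 | | exact: vge0].
by rewrite mul1r addNr; apply: (vge_natr 1).
Qed.

End Inversion.

Lemma ps_eval_linear (p : nat) (p_pr : prime p) (mu : rat) (v v' x : padic p_pr) :
    0 < mu -> vge 0 v -> vge 0 v' -> vge 0 x ->
  ps_eval (fun k => (v%:P + v'%:P * 'X)`_k) x = v + v' * x.
Proof.
move=> mu0 v0 v'0 x0; have v'x : vge 0 (v' * x) by rewrite -[0]addr0; apply: vgeM.
have E : (fun k => (v%:P + v'%:P * 'X)`_k) =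
    (fun k => if k is k'.+1 then if k' is 0%N then v' else 0 else v).
  apply/funext => k; rewrite coefD coefC coefCM coefX.
  by case: k => [|[|k]] /=; rewrite ?(mulr0, mulr1, addr0, add0r).
rewrite E; apply: (@ps_eval_eq _ _ (- mu) mu) => // n; rewrite /psum.
case: n => [|[|n]].
- rewrite big_ord0 subr0 mul0r addr0; apply: vgeD.
    by apply: vge_le v0; rewrite oppr_le0 ltW.
  by apply: vge_le v'x; rewrite oppr_le0 ltW.
- by rewrite big_ord1 mulr1 [v + _]addrC addrK mul1r addNr.
- rewrite !big_ord_recl big1 ?addr0 /= ?mulr1 ?subrr; first exact: vge0.
  by move=> k _; rewrite mul0r.
Qed.

(** * The power series ftilde and the congruence *)

Theorem lemma9 (p : nat) (p_pr : prime p) (w : int) (u kappa : nat)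
    (lam y : rat) (omega omega' : padic_int p_pr) (f : nat -> padic p_pr)
    (u_gt0 : (0 < u)%N)
    (kappa_gt0 : (0 < kappa)%N)
    (kappa_ge : 1 + iota'_p p 2 <= kappa%:Z)
    (lam_rho : exists2 n : nat, (0 < n)%N & lam = rho p * n%:R)
    (y_gt0 : 0 < y)
    (omega_unit : omega \is a GRing.unit)
    (omega'_unit : omega' \is a GRing.unit)
    (f_F : class_F w y kappa lam u omega omega' f)
    (u_gt : kappa%:Z - Num.floor lam + iota'_p p y < u%:Z) :
  let lamt : rat := Num.min (kappa%:R - rho_at p y) lam in
  0 < lamt ->
  let e : int := iota_p p y + kappa%:Z in
  let e' : int := iota'_p p y + kappa%:Z in
  let f'_red (m : padic p_pr) : padic p_pr :=
    ps_eval (ps_deriv f) m * p%:R ^ (- w) in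
  exists2 gtilde0 : padic_int p_pr, gtilde0%:Qp = f'_red 0 - omega'%:Qp &
  exists ftilde : nat -> padic p_pr,
  [/\ In0w lamt ftilde,
      exists2 gtilde, In0w lamt gtilde &
        forall k, ftilde k =
          p%:R ^ (- e) * omega%:Qp^-1
            * binomial_ps (- y^-1) (p%:R ^ e') k
          - (p%:R ^ (- e) * omega%:Qp^-1)%:P`_k
          + p%:R ^ (u%:Z + Num.floor lam - kappa%:Z - iota'_p p y) * gtilde k,
      forall k, ps_comp (ps_deriv f) ftilde k * p%:R ^ (- w) =
        (gtilde0%:Qp%:P
          + omega'%:Qp%:P * (1 + (p%:R ^ e')%:P * 'X))`_k
    & forall (j : int) (s' : padic_int p_pr), e' <= j ->
      ((exists m : padic_int p_pr, eq_mod_pow j (f'_red m%:Qp) s'%:Qp)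
         <-> eq_mod_pow e' s'%:Qp (gtilde0%:Qp + omega'%:Qp))
      /\
      (eq_mod_pow e' s'%:Qp (gtilde0%:Qp + omega'%:Qp) ->
       let line (t : padic_int p_pr) : padic p_pr :=
         gtilde0%:Qp + omega'%:Qp * (1 + p%:R ^ e' * t%:Qp) in
       (exists t, s'%:Qp = line t)
       /\
       forall t, eq_mod_pow j s'%:Qp (line t) ->
         (forall t', eq_mod_pow j s'%:Qp (line t') <-> eq_mod_pow (j - e') t'%:Qp t%:Qp)
         /\
         (forall m : padic_int p_pr,
            eq_mod_pow j (f'_red m%:Qp) s'%:Qp
              <-> eq_mod_pow (j - e') m%:Qp (ps_eval ftilde t%:Qp)))].

Proof.
move=> mu mu0 e e' f'_red.
case: f_F => _ [gamma0 [g gI fE]].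
have g_bnd k : vge (k%:R * lam) (g k) by apply/padic_ordP; apply: gI.2.
have mu_lam : mu <= lam by rewrite /mu ge_min lexx orbT.
have mu_kappa : mu <= kappa%:R - rho_at p y by rewrite /mu ge_min lexx.
have eE : e = iota_p p y + kappa%:Z by [].
have e'E : e' = iota'_p p y + kappa%:Z by [].
clearbody mu e e'.
have e'_ge0 : 0 <= e' by rewrite e'E /iota'_p; lia.
(* The exponent in front of gtilde. As c + e' = u + floor lam, it measures the perturbation relative
   to p^e'; the hypothesis on u says c > 0. *)
pose c : int := u%:Z + Num.floor lam - kappa%:Z - iota'_p p y.
have c_gt0 : 0 < c by rewrite /c; lia.
have ce' : c%:~R + e'%:~R <= u%:Z%:~R + lam.
  rewrite -rmorphD /= (_ : c + e' = u%:Z + Num.floor lam); last by rewrite /c e'E; ring.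
  by rewrite rmorphD lerD2l floor_le.
(* Psi = p^(-w) f' and p^e' omega' beta is its binomial part without constant *)
(* term; H is the compositional inverse of beta.                              *)
pose b : nat -> padic p_pr := binomial_ps (- y) (p%:R ^ e * omega%:Qp).
pose beta k := p%:R ^ (- e') * (b k - 1%:P`_k).
pose H k := p%:R ^ (- e) * omega%:Qp^-1 * binomial_ps (- y^-1) (p%:R ^ e') k
  - (p%:R ^ (- e) * omega%:Qp^-1)%:P`_k.
have [[z uz beta1] betamu H0 Hmu betaH] : [/\ exists2 z, z \is a GRing.unit & beta 1%N = z%:Qp,
    bnd (- mu) mu beta, H 0%N = 0, bnd (- mu) mu H & ps_comp beta H =1 (fun k => 'X`_k)].
  exact: (@binomial_reversion _ _ y mu kappa e e' omega b).
have b0 : b 0%N = 1 by rewrite /b /binomial_ps gbinom0 mulr1.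
have beta0 : beta 0%N = 0.
  by rewrite /beta b0 coefC subrr mulr0.
pose Psi k := omega'%:Qp * b k + gamma0%:Qp%:P`_k + p%:R ^ u%:Z * g k.
pose g' k := g k - (g 0%N)%:P`_k.
have bE k : b k = p%:R ^ e' * beta k + 1%:P`_k.
  by rewrite /beta mulrA -expfzDr ?padic_p_neq0 // subrr mul1r subrK.
have polyZE (F : fieldType) (s v : F) k : (s * v)%:P`_k = s * v%:P`_k.
  by rewrite !coefC; case: ifP; rewrite ?mulr0.
have splitE (F : fieldType) (o q v s r r0 v0 : F) k :
    o * (q * v + 1%:P`_k) + v0%:P`_k + s * r =
    q * o * v + s * (r - r0%:P`_k) + (o + v0 + s * r0)%:P`_k.
  by rewrite !coefC; case: ifP => _; ring.
have linE (F : fieldType) (v q o r s : F) k :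
    q * o * r + s + v%:P`_k = (v%:P + (q * o)%:P * 'X)`_k ->
    q * (o * (r - 'X`_k)) = - s.
  rewrite coefD coefCM [RHS]addrC => /addIr h.
  by rewrite mulrA mulrBr -h; ring.
have targetE (F : fieldType) (q q' v v' o d : F) k : v' = v - o -> q * q' = 1 ->
    (q * (v%:P + (d * o)%:P * 'X)`_k + 0%:P`_k) * q' =
    (v'%:P + o%:P * (1 + d%:P * 'X))`_k.
  move=> -> qq'.
  have -> : (v - o)%:P + o%:P * (1 + d%:P * 'X) = v%:P + (d * o)%:P * 'X.
    by rewrite polyCB polyCM; ring.
  by rewrite polyC0 coef0 addr0 mulrAC qq' mul1r.
have Psi0E : Psi 0%N = omega'%:Qp + gamma0%:Qp + p%:R ^ u%:Z * g 0%N.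
  by rewrite /Psi b0 mulr1 coefC.
have c_ge1 : 1 <= c%:~R :> rat by rewrite ler1z -gtz0_ge1.
have derivE : ps_deriv f = fun k => p%:R ^ w * Psi k.
  apply/funext => k; rewrite fE -eE -/(b k) polyZE expfzDr ?padic_p_neq0 // /Psi.
  by ring.
have PsiE k : Psi k = (p%:R ^ e' * omega'%:Qp) * beta k + p%:R ^ u%:Z * g' k + (Psi 0%N)%:P`_k.
  by rewrite Psi0E /Psi bE /g'; apply: splitE.
clearbody Psi beta.
have g'0 : g' 0%N = 0 by rewrite /g' coefC subrr.
have g'S k : g' k.+1 = g k.+1 by rewrite /g' coefC subr0.
clearbody g'.
have PsiSE k : Psi k.+1 = (p%:R ^ e' * omega'%:Qp) * beta k.+1 + p%:R ^ u%:Z * g k.+1.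
  by rewrite PsiE g'S coefC /= addr0.
have PsiS k : vge (e'%:~R + k%:R * mu) (Psi k.+1).
  rewrite PsiSE; apply: vgeD; [rewrite -mulrA|]; apply/vge_expM.
    rewrite addrAC subrr add0r; apply/(vge_unitM _ _ omega'_unit).
    by apply: vge_le (betamu k.+1); rewrite -addn1 natrD; lra.
  apply: vge_le (g_bnd k.+1).
  rewrite -addn1 natrD; have := ler_wpM2l (ler0n rat k) mu_lam; lra.
(* Since c >= 1, the perturbation adds a multiple of p^(e'+1) to p^e' omega' z. *)
have [theta utheta Psi1] : exists2 t, t \is a GRing.unit & Psi 1%N = p%:R ^ e' * t%:Qp.
  have [v vE] : exists v : padic_int p_pr, p%:R ^ u%:Z * g 1%N = p%:R ^ (e' + 1) * v%:Qp.
    apply/vge_expP/vge_expM/(vge_le _ (g_bnd 1%N)); rewrite rmorphD mul1r.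
    by rewrite /=; lra.
  exists (omega' * z + p%:R * v).
    by apply: padic_int_unitD; rewrite unitrM omega'_unit.
  rewrite PsiSE beta1 vE expfzDr ?padic_p_neq0 // expr1z.
  by rewrite rmorphD !rmorphM rmorph_nat; ring.
have Psi0 : vge 0 (Psi 0%N).
  rewrite Psi0E; apply: vgeD; first by apply: vgeD; apply: vge_of_int.
  apply/vge_expM; apply: vge_le (g_bnd 0%N); rewrite sub0r mul0r.
  by rewrite oppr_le0 ler0z.
have Psimu : bnd (- mu) mu Psi.
  case=> [|k]; first by apply: vge_le Psi0; rewrite mul0r addr0 oppr_le0 ltW.
  apply: vge_le (PsiS k); rewrite -addn1 natrD.
  have : 0 <= e'%:~R :> rat by rewrite ler0z.
  lra.
have f'_redE m : vge 0 m -> f'_red m = ps_eval Psi m.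
  by move=> m0; rewrite /f'_red derivE (ps_evalZ _ mu0 Psimu m0) mulrAC -expfzDr
    ?padic_p_neq0 // subrr mul1r.
have [G0 Psi0G] : exists G0 : padic_int p_pr, Psi 0%N = G0%:Qp by apply/padic_integralP.
have f'_red0 : f'_red 0 = Psi 0%N by rewrite f'_redE ?(ps_eval0 mu0 Psimu) //; apply: vge0.
have [X [X0 Xmu XE]] := ps_comp_solve omega' mu0 utheta Psi1 PsiS.
have gtE : (G0 - omega')%:Qp = Psi 0%N - omega'%:Qp by rewrite Psi0G rmorphB.
exists (G0 - omega'); first by rewrite f'_red0.
have lineE (t : padic p_pr) : (G0 - omega')%:Qp + omega'%:Qp * (1 + p%:R ^ e' * t) =
    Psi 0%N + (p%:R ^ e' * omega'%:Qp) * t.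
  by rewrite gtE; ring.
have eval_line t : vge 0 t ->
    ps_eval Psi (ps_eval X t) = Psi 0%N + (p%:R ^ e' * omega'%:Qp) * t.
  move=> t0; rewrite (ps_eval_comp mu0 Psimu X0 Xmu t0).
  have -> : ps_comp Psi X =
      (fun k => ((Psi 0%N)%:P + (p%:R ^ e' * omega'%:Qp)%:P * 'X)`_k) by exact/funext.
  apply: ps_eval_linear mu0 Psi0 _ t0.
  rewrite -[0]addr0; apply: vgeM; last exact: vge_of_int.
  by apply: vge_le (vge_exp e'); rewrite ler0z.
have Psi_congr j m m' : vge 0 m -> vge 0 m' ->
    vge j%:~R (ps_eval Psi m - ps_eval Psi m') <-> vge (j - e')%:~R (m - m').
  move=> m0 m'0.
  exact: (ps_eval_congr j mu0 utheta Psi1 PsiS Psimu m0 m'0).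
have X_int t : vge 0 t -> vge 0 (ps_eval X t) by apply: vge_ps_eval X0 Xmu.
exists X; split.
- exact: In0w_bnd mu0 X0 Xmu.
- exists (fun k => p%:R ^ (- c) * (X k - H k)); last first.
    move=> k; rewrite -/c -/(H k) mulrA -expfzDr ?padic_p_neq0 // subrr mul1r.
    by rewrite subrKC.
  apply: In0w_bnd => //; first by rewrite X0 H0 subrr mulr0.
  move=> k; apply/vge_expM; rewrite rmorphN opprK addrC addrA.
  move: k; apply: (bnd_ps_comp_inj _ uz beta1 betamu X0 H0 Hmu); first by rewrite ler0z ltW.
  (* Without constant term, the perturbation gains a full lam: i lam >= lam + (i - 1) mu for i >=
     1. *)
  move=> k; have g'X : bnd (lam - mu) mu (ps_comp g' X).
    apply: bnd_ps_comp X0 _ Xmu => -[|i].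
      by rewrite g'0; apply: vge0.
    rewrite g'S; apply: vge_le (g_bnd i.+1).
    rewrite -addn1 natrD; have := ler_wpM2l (ler0n rat i) mu_lam; lra.
  (* Subtract p^e' omega' beta(H) = p^e' omega' t from the equation solved by X. *)
  have compE : p%:R ^ e' * (omega'%:Qp * (ps_comp beta X k - ps_comp beta H k)) =
      - (p%:R ^ u%:Z * ps_comp g' X k).
      rewrite betaH; apply: (linE _ (Psi 0%N)).
    by rewrite -XE (ps_comp_comb _ PsiE).
  apply/(vge_unitM _ _ omega'_unit).
  have -> : c%:~R - mu + k%:R * mu = (c%:~R + e'%:~R - mu + k%:R * mu) - e'%:~R by ring.
  apply/vge_expM; rewrite compE; apply: vgeN; apply/vge_expM; apply: vge_le (g'X k).
  lra.
- move=> k; rewrite derivE.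
  rewrite (@ps_comp_affine _ p_pr (p%:R ^ w) 0 _ Psi) => [|i].
    by rewrite XE; apply: (targetE _ _ _ _ _ _ _ _ gtE); rewrite -expfzDr ?padic_p_neq0 // subrr.
  by rewrite coefC if_same addr0.
move=> j s' e'j.
(* Comparison with m = 0: all values lie in one class modulo p^e', which makes the condition on s'
   necessary. *)
have near_Psi0 (m : padic_int p_pr) : vge e'%:~R (f'_red m%:Qp - Psi 0%N).
  rewrite f'_redE; last exact: vge_of_int.
  rewrite -f'_red0 f'_redE; last exact: vge0.
  apply/Psi_congr; [exact: vge_of_int | exact: vge0 |].
  by rewrite subrr subr0; apply: vge_of_int.
have sumE : (G0 - omega')%:Qp + omega'%:Qp = Psi 0%N by rewrite gtE subrK.
have solve_line : eq_mod_pow e' s'%:Qp ((G0 - omega')%:Qp + omega'%:Qp) ->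
    exists t : padic_int p_pr, s'%:Qp = Psi 0%N + (p%:R ^ e' * omega'%:Qp) * t%:Qp.
  rewrite sumE => -[v vE]; exists (omega'^-1 * v).
  rewrite -(subrKC (Psi 0%N) s'%:Qp) vE; congr (_ + _).
  by rewrite -mulrA -rmorphM mulrA divrr // mul1r.
split; first split.
- move=> [m /eq_mod_powP fm]; apply/eq_mod_powP; rewrite sumE.
  rewrite -[_ - _](subrKA (f'_red m%:Qp)); apply: vgeD => //.
  by rewrite -opprB; apply/vgeN/(vge_le _ fm); rewrite ler_int.
(* The value m = ftilde(t) solves the equation exactly, hence modulo every p^j. *)
- move=> /solve_line[t tE]; have t0 := vge_of_int t.
  have /padic_integralP[m mE] := X_int _ t0.
  exists m; apply/eq_mod_powP; rewrite -mE f'_redE; last exact: X_int.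
  by rewrite eval_line // tE subrr; apply: vge0.
move=> /solve_line s'_line line; split.
  by have [t tE] := s'_line; exists t; rewrite /line lineE.
move=> t /eq_mod_powP; rewrite /line lineE => st.
have t0 := vge_of_int t; split=> [t'|m].
  rewrite !eq_mod_powP lineE.
  have d : vge j%:~R (s'%:Qp - (Psi 0%N + p%:R ^ e' * omega'%:Qp * t'%:Qp)
      - p%:R ^ e' * (omega'%:Qp * (t%:Qp - t'%:Qp))).
    by move: st; congr vge; ring.
  rewrite (vge_congr d) vge_expM (vge_unitM _ _ omega'_unit) rmorphB /=.
  by split=> /vgeN; rewrite opprB.
(* Closeness of m to ftilde(t) becomes closeness of their values, and the value at ftilde(t) is s'
   modulo p^j. *)
rewrite !eq_mod_powP -Psi_congr ?eval_line //; [|exact: vge_of_int|exact: X_int].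
rewrite f'_redE; last exact: vge_of_int.
apply: vge_congr; rewrite opprB addrC subrKA.
by rewrite -opprB; apply: vgeN.
Qed.
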